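(* For any $n\ge1$ and any degrees $d_1,\ldots,d_n\ge 1$, $$H(\mathrm{Res}_{d_1,\ldots,d_n})\le\prod_{i=1}^n\binom{d_i+n-1}{n-1}^{\delta_i},$$ where $\delta_i=\prod_{1\le j\le n,\ j\ne i}d_j$.
   Context: For a polynomial $G$ with complex coefficients, the height $H(G)$ is the maximum modulus of a coefficient of $G$. $\mathrm{Res}_{d_1,\ldots,d_n}$ denotes the multidimensional resultant: writing $F_i=\sum_{|\alpha|=d_i}a_{i,\alpha}x^\alpha$, $1\le i\le n$, for homogeneous forms of degree $d_i$ in $x_1,\ldots,x_n$, it is the unique polynomial in the coefficients $a_{i,\alpha}$ such that, over $\mathbb{C}$: (A1) it vanishes iff $F_1,\ldots,F_n$ have a common zero in $\mathbb{C}^n\setminus\{0\}$; (A2) for each $i$, it is homogeneous of degree $\prod_{j\ne i}d_j$ in the coefficients of $F_i$; (A3) it equals $1$ when $F_i=x_i^{d_i}$ for all $i$. Empty products are $1$. *)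

(* Defs.v *)
From HB Require Import structures.
From mathcomp Require Import all_boot all_order all_algebra.
From mathcomp Require Import reals complex mpoly.

Set Implicit Arguments.
Unset Strict Implicit.
Unset Printing Implicit Defensive.

Import Order.TTheory GRing.Theory Num.Theory.
Local Open Scope ring_scope.

(* Here the field of complex numbers is R[i] with R : realType; the modulus is
   taken as the real number [normc z] because `|z| lives in R[i] itself. *)
Definition height (R : realType) (N : nat) (G : {mpoly R[i][N]}) : R :=
  \big[Num.max/0]_(m <- msupp G) ComplexField.Normc.normc (G@_m).

(* The index (i, alpha), with |alpha| = d i, of the variable a_{i,alpha}.
   'X_{1..n < k} only bounds the total degree strictly by k and is used to get
   a finite type. *)
Definition coefidx (n : nat) (d : 'I_n -> nat) : finType :=
  {i : 'I_n & {alpha : 'X_{1..n < (d i).+1} | mdeg alpha == d i}}.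

Definition form_of (n : nat) (d : 'I_n -> nat) (v : coefidx d) : 'I_n := tag v.

Definition mon_of (n : nat) (d : 'I_n -> nat) (v : coefidx d) : 'X_{1..n} :=
  val (val (tagged v)).

(* [{mpoly _[N]}] has its variables indexed by 'I_N: the variable a_{i,alpha}
   is the one of rank [enum_rank (i, alpha)] in [coefidx d]. *)
Definition coefpoly (R : realType) (n : nat) (d : 'I_n -> nat) : Type :=
  {mpoly R[i][#|coefidx d|]}.

Definition eval_at_forms (R : realType) (n : nat) (d : 'I_n -> nat)
    (P : coefpoly R d) (F : 'I_n -> {mpoly R[i][n]}) : R[i] :=
  P.@[fun k => let v := enum_val k in (F (form_of v))@_(mon_of v)].

Definition delta (n : nat) (d : 'I_n -> nat) (i : 'I_n) : nat :=
  (\prod_(j < n | j != i) d j)%N.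

Definition partial_mdeg (n : nat) (d : 'I_n -> nat)
    (m : 'X_{1..#|coefidx d|}) (i : 'I_n) : nat :=
  (\sum_(v : coefidx d | form_of v == i) m (enum_rank v))%N.

Record is_resultant (R : realType) (n : nat) (d : 'I_n -> nat)
    (P : coefpoly R d) : Prop := IsResultant {
  resultant_vanish : forall F : 'I_n -> {mpoly R[i][n]},
    (forall i, F i \is (d i).-homog) ->
    eval_at_forms P F = 0 <->
    exists2 x : 'I_n -> R[i], (exists j, x j != 0) & forall i, (F i).@[x] = 0;
  resultant_homog : forall (i : 'I_n) (m : 'X_{1..#|coefidx d|}),
    m \in msupp P -> partial_mdeg m i = delta d i;
  resultant_normalized : eval_at_forms P (fun i => 'X_i ^+ d i) = 1
}.

(* Main.v *)
Require Import Defs.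
From HB Require Import structures.
From mathcomp Require Import all_boot all_order all_fingroup all_algebra.
From mathcomp Require Import cyclic separable cyclotomic.
From mathcomp Require Import boolp reals complex mpoly.
From mathcomp Require Import ring zify.

Set Implicit Arguments.
Unset Strict Implicit.
Unset Printing Implicit Defensive.

Import Order.TTheory GRing.Theory Num.Theory.
Local Open Scope ring_scope.

(** Every coefficient is an average of values on the unit torus, so it suffices
    to show |Res(F)| <= prod_i N_i^(delta_i) when all coefficients of F have
    modulus at most 1, where N_i is the number of monomials of F_i
    ([coef_bound]).

    If all forms but the i-th are fixed, (A1) and (A2) force
    Res(F) = c prod_l F_i(x_l) for common zeros x_l of the other forms
    ([splitting], [resultant_value_split]). As |F_i(x)| <= N_i max_b |x_b|^(d_i),
    one would like to replace F_i by a form as large as max_b |x_b|^(d_i) at all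
    the x_l. Such forms exist only in high degree and up to a bounded factor:
    among the forms sum_b t_b x_b^(d_i kappa) with integers 0 <= t_b <= M, one
    satisfies max_b |x_b|^(d_i kappa) <= (2M)^n |sum_b t_b x_b^(d_i kappa)| at M
    given points ([good_weights]). Doing this for i = n-1, ..., 0 with
    kappa_i = rho delta_i, all new forms have the common degree rho prod_j d_j,
    they are linear in the powers of the variables, and the resultant has become
    a power of the determinant of (t_ib). This bounds |Res(F)|^rho by
    (prod_i N_i^(delta_i))^rho times a quantity that is polynomial in rho
    ([resultant_power_bound]), and rho may tend to infinity ([le_of_power_le]).

    Only Res itself is given, so the resultants of the intermediate systems have
    to be constructed. If V = c prod_l h(x_l) as a function of the coefficients h
    of the i-th form, the new function is c^kappa prod_l h(x_l^kappa), where the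
    monomials of the i-th form are raised to the power kappa ([raise]). The
    difficulty is that it depends polynomially on the coefficients of the other
    forms. On a line it is a rational function, because the product is a
    symmetric expression in the x_l and is recovered from values of V by Newton's
    identities and polarization ([multisymmetric]); it is dominated by the values
    of V, again by [good_weights], so it has no pole ([dominated_dvd],
    [power_transform_poly]). That it splits over the common zeros in the other
    forms as well holds because the other possible components of its zero set
    have codimension 2 ([raise_split]). *)

(** * Polynomials dominated by polynomials *)

Section DominatedPolynomials.
Variable C : numClosedFieldType.
Implicit Types (p q A B D Q : {poly C}).

Lemma exists_nonroot B (z : nat -> C) : B != 0 -> injective z ->
  exists j, B.[z j] != 0.
Proof.
move=> B0 zI; apply: contrapT => H.
have : (size (mkseq z (size B)) < size B)%N.
  apply: max_poly_roots => //.
    by apply/allP => x /mapP [j _ ->]; apply/negP => /negP Hj; apply: H; exists j.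
  by rewrite map_inj_uniq // iota_uniq.
by rewrite size_mkseq ltnn.
Qed.

Lemma horner_lipschitz p x : exists2 K : C, 0 <= K &
  forall z, `|z| <= 1 -> `|p.[x + z] - p.[x]| <= K * `|z|.
Proof.
have /factor_theorem [q Hq] : root (p - p.[x]%:P) x.
  by rewrite /root hornerD hornerN hornerC subrr.
exists (\sum_(i < size q) `|q`_i| * (`|x| + 1) ^+ i).
  by apply: sumr_ge0 => i _; rewrite mulr_ge0 // exprn_ge0 // addr_ge0.
move=> z z1.
have -> : p.[x + z] - p.[x] = q.[x + z] * z.
  have := congr1 (horner^~ (x + z)) Hq.
  rewrite /= hornerD hornerN hornerC hornerM hornerXsubC => ->.
  by congr (_ * _); ring.
rewrite normrM ler_wpM2r // horner_coef.
apply: le_trans (ler_norm_sum _ _ _) _; apply: ler_sum => i _.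
rewrite normrM normrX ler_wpM2l // lerXn2r ?nnegrE ?addr_ge0 //.
by apply: le_trans (ler_normD _ _) _; rewrite lerD2l.
Qed.

(** The exceptional roots of [B] are harmless by continuity: some of the points
    x + e / (j+1) is not a root of [B], and [e] can be taken so small that the
    sum is below |Q(x)| there. *)
Lemma dominated_root (I : finType) (R : I -> {poly C}) B Q x :
  B != 0 -> (forall s, B.[s] != 0 -> `|Q.[s]| <= \sum_i `|(R i).[s]|) ->
  (forall i, (R i).[x] = 0) -> Q.[x] = 0.
Proof.
move=> B0 HQ HR; apply: contrapT => /eqP Qx.
have [K K0 HK] := horner_lipschitz Q x.
have [L HL] : exists L : I -> C, forall i, 0 <= L i /\
    forall z, `|z| <= 1 -> `|(R i).[x + z]| <= L i * `|z|.
  suff /choice [L HL] : forall i, exists l : C, 0 <= l /\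
      forall z, `|z| <= 1 -> `|(R i).[x + z]| <= l * `|z| by exists L.
  move=> i; have [l l0 Hl] := horner_lipschitz (R i) x.
  by exists l; split => // z /Hl; rewrite HR subr0.
set S := K + \sum_i L i.
have S0 : 0 <= S by rewrite addr_ge0 // sumr_ge0 // => i _; case: (HL i).
set N := `|Q.[x]|.
have N0 : 0 < N by rewrite normr_gt0.
have N0' : 0 < N + S + 1 by rewrite ltr_wpDl ?ltr01 // addr_ge0 // ltW.
pose e := N / (N + S + 1).
have e0 : 0 < e by rewrite divr_gt0.
pose z j : C := e / j.+1%:R.
have zI : injective z.
  move=> i j /(mulfI (lt0r_neq0 e0)) /invr_inj /eqP.
  by rewrite eqr_nat => /eqP [].
have z0 j : 0 < z j by rewrite divr_gt0 // ltr0n.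
have ze j : z j <= e by rewrite ler_pdivrMr ?ltr0n // ler_peMr ?ler1n // ltW.
have e1 : e <= 1.
  by rewrite ler_pdivrMr // mul1r -addrA lerDl addr_ge0.
have [j Hj] : exists j, (B \Po ('X + x%:P)).[z j] != 0.
  apply: exists_nonroot => //.
  by rewrite comp_poly2_eq0 // size_XaddC.
rewrite horner_comp !hornerE addrC in Hj.
have zn : `|z j| = z j by rewrite ger0_norm // ltW.
have z1 : `|z j| <= 1 by rewrite zn (le_trans (ze j)).
have : N <= S * z j.
  rewrite /N -[Q.[x]](subKr Q.[x + z j]).
  apply: le_trans (ler_normB _ _) _.
  rewrite /S mulrDl addrC lerD //.
    by apply: le_trans (HK _ z1) _; rewrite zn.
  apply: le_trans (HQ _ Hj) _; rewrite mulr_suml; apply: ler_sum => i _.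
  by case: (HL i) => _ /(_ _ z1); rewrite zn.
apply/negP/negbT/lt_geF.
apply: le_lt_trans (ler_wpM2l S0 (ze j)) _.
by rewrite mulrA ltr_pdivrMr // [_ * N]mulrC ltr_pM2l // -addrA addrCA ltrDl addr_gt0.
Qed.

Definition reverse_poly d p := \poly_(i < d.+1) p`_(d - i).

Lemma horner_reverse_poly d p x : (size p <= d.+1)%N -> x != 0 ->
  (reverse_poly d p).[x] = x ^+ d * p.[x^-1].
Proof.
move=> sp x0; rewrite horner_poly (horner_coef_wide _ sp) mulr_sumr.
rewrite (reindex_inj rev_ord_inj); apply: eq_bigr => i _ /=.
have Hi : (i <= d)%N by rewrite -ltnS.
rewrite subSS subKn // mulrCA; congr (_ * _).
by rewrite exprVn -expfB_cond // (negbTE x0).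
Qed.

Lemma reverse_poly_neq0 d p : (size p <= d.+1)%N -> p != 0 -> reverse_poly d p != 0.
Proof.
move=> sp p0; apply: contra_neq p0 => r0; apply/polyP => i; rewrite coef0.
case: (leqP i d) => Hi.
  have := congr1 (fun q : {poly C} => q`_(d - i)) r0.
  by rewrite coef0 coef_poly ltnS leq_subr subKn.
by rewrite nth_default // (leq_trans sp).
Qed.

(** The previous lemma at infinity, that is, at 0 for the reversed polynomials. *)
Lemma dominated_size (I : finType) (R : I -> {poly C}) B Q d :
  B != 0 -> (forall s, B.[s] != 0 -> `|Q.[s]| <= \sum_i `|(R i).[s]|) ->
  (forall i, (size (R i) <= d)%N) -> (size Q <= d)%N.
Proof.
move=> B0 HQ HR; rewrite leqNgt; apply/negP => Hd.
pose k := (size Q).-1.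
have sQ : size Q = k.+1 by rewrite prednK // (leq_trans _ Hd).
have Hdk : (d <= k)%N by rewrite -ltnS -sQ.
pose b := size B.
have sB : (size B <= b.+1)%N by rewrite ltnW.
have : (reverse_poly k Q).[0] = 0.
  apply: (@dominated_root I (fun i => reverse_poly k (R i))
            ('X * reverse_poly b B)).
  - by rewrite mulf_neq0 ?polyX_eq0 ?reverse_poly_neq0.
  - move=> s; rewrite hornerM hornerX mulf_eq0 negb_or => /andP [s0].
    rewrite (horner_reverse_poly sB) // mulf_eq0 negb_or => /andP [_ Bs].
    rewrite horner_reverse_poly ?sQ // normrM.
    apply: le_trans (ler_wpM2l (normr_ge0 _) (HQ _ Bs)) _.
    rewrite mulr_sumr; apply: ler_sum => i _.
    by rewrite horner_reverse_poly ?normrM // (leq_trans (HR i)) // (leq_trans Hdk).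
  - by move=> i; rewrite horner_coef0 coef_poly /= subn0 nth_default // (leq_trans (HR i)).
rewrite horner_coef0 coef_poly /= subn0 => /eqP.
by rewrite (_ : k = (size Q).-1) // -lead_coefE lead_coef_eq0 -size_poly_eq0 sQ.
Qed.

(** A rational function [A / D] that is locally bounded has no pole; the roots of
    [D] are cancelled one at a time. *)
Lemma dominated_dvd (I : finType) (R : I -> {poly C}) B A D :
  B != 0 -> D != 0 ->
  (forall s, B.[s] != 0 -> `|A.[s]| <= `|D.[s]| * \sum_i `|(R i).[s]|) ->
  exists Q, A = D * Q.
Proof.
have [n] := ubnP (size D); elim: n => // n IH in A B D *.
move=> sD B0 D0 HA; have [/size_poly1P [c c0 ->]|sD1] := boolP (size D == 1%N).
  by exists (c^-1 *: A); rewrite mul_polyC scalerA divff // scale1r.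
have /closed_rootP [x /eqP Dx] := sD1.
have /eqP/factor_theorem [A1 EA] : A.[x] = 0.
  apply: (dominated_root (R := fun i => D * R i) B0) => [s Bs|i].
    apply: le_trans (HA _ Bs) _; rewrite mulr_sumr; apply: ler_sum => i _.
    by rewrite hornerM normrM.
  by rewrite hornerM Dx mul0r.
have /factor_theorem [D1 ED] : root D x by apply/eqP.
have D10 : D1 != 0 by apply: contra_neq D0; rewrite ED => ->; rewrite mul0r.
have [||| s|Q EQ] := IH A1 (B * ('X - x%:P)) D1.
- by move: sD; rewrite ED size_Mmonic ?monicXsubC // size_XsubC addn2 /= ltnS.
- by rewrite mulf_neq0 // polyXsubC_eq0.
- by [].
- rewrite hornerM hornerXsubC mulf_eq0 negb_or => /andP [Bs xs].
  have := HA _ Bs; rewrite EA ED !hornerM hornerXsubC !normrM mulrAC.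
  by rewrite ler_pM2r // normr_gt0.
- by exists Q; rewrite EA ED EQ mulrAC.
Qed.

(** Lagrange interpolation at the nodes 0, 1, ..., d-1, read coefficientwise. *)
Lemma coef_interpolation d r : exists w : 'I_d -> C,
  forall p, (size p <= d)%N -> p`_r = \sum_i w i * p.[(val i)%:R].
Proof.
pose L (i : 'I_d) : {poly C} :=
  \prod_(j < d | j != i) (((val i)%:R - (val j)%:R)^-1 *: ('X - (val j)%:R%:P)).
have LE (i j : 'I_d) : (L i).[(val j)%:R] = (i == j)%:R.
  rewrite horner_prod; have [<-|ij] := eqVneq i j.
    rewrite big1 // => l li; rewrite hornerZ hornerXsubC mulVf // subr_eq0 eqr_nat.
    by rewrite eq_sym.
  rewrite (bigD1 j) 1?eq_sym //=.
  by rewrite hornerZ hornerXsubC subrr mulr0 mul0r.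
exists (fun i => (L i)`_r) => p sp.
suff -> : p = \sum_i p.[(val i)%:R] *: L i.
  rewrite coef_sum; apply: eq_bigr => i _; rewrite coefZ mulrC; congr (_ * _).
  rewrite horner_sum (bigD1 i) //= hornerZ LE eqxx mulr1 big1 ?addr0 // => j ji.
  by rewrite hornerZ LE (negbTE ji) mulr0.
apply/eqP; rewrite -subr_eq0; set q := p - _; apply/eqP.
apply: (@roots_geq_poly_eq0 _ _ [seq (val i)%:R | i : 'I_d]).
- apply/allP => x /mapP [i _ ->]; rewrite /root hornerD hornerN horner_sum.
  rewrite (bigD1 i) //= hornerZ LE eqxx mulr1 big1 ?addr0 ?subrr // => j ji.
  by rewrite hornerZ LE (negbTE ji) mulr0.
- rewrite map_inj_uniq ?enum_uniq // => i j /eqP; rewrite eqr_nat => /eqP.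
  exact: val_inj.
- rewrite size_map size_enum_ord; apply: leq_trans (size_polyD _ _) _.
  rewrite size_polyN geq_max sp; apply: leq_trans (size_sum _ _ _) _.
  apply/bigmax_leqP => i _; apply: leq_trans (size_scale_leq _ _) _.
  apply: leq_trans (size_prod_leq _ _) _.
  have sz (j : 'I_d) : j != i -> (size (((val i)%:R - (val j)%:R)^-1 *: ('X - (val j)%:R%:P) : {poly C}) <= 2)%N.
    by move=> _; apply: leq_trans (size_scale_leq _ _) _; rewrite size_XsubC.
  have := @leq_sum _ (index_enum _) (fun j => j != i) _ (fun=> 2%N) sz.
  rewrite sum_nat_const (eq_card (B := predC1 i)) // cardC1 card_ord.
  move=> H; rewrite leq_subLR; apply: leq_ltn_trans H _.
  by move: (ltn_ord i); lia.
Qed.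

End DominatedPolynomials.

(** * Functions that are polynomial on every line *)

Section LinePolynomials.
Variables (C : numClosedFieldType) (T : finType).
Implicit Types (a b h y u : T -> C) (f g : (T -> C) -> C).

Definition dot h y : C := \sum_t h t * y t.

Definition line a b (s : C) : T -> C := fun t => a t + s * b t.

(** On a finite-dimensional space this amounts to being a polynomial function,
    but it is stable under restriction to affine subspaces by its very form, and
    it can be checked one parameter at a time. *)
Definition linepoly D f := forall a b,
  exists2 p : {poly C}, (size p <= D)%N & forall s, f (line a b s) = p.[s].

Lemma dot_line a b s y : dot (line a b s) y = dot a y + s * dot b y.
Proof.
rewrite /dot mulr_sumr -big_split; apply: eq_bigr => t _ /=.
by rewrite /line mulrDl mulrA.
Qed.

Lemma dotZl (c : C) h y : dot (fun t => c * h t) y = c * dot h y.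
Proof. by rewrite /dot mulr_sumr; apply: eq_bigr => t _; rewrite mulrA. Qed.

Lemma dotZr (c : C) h y : dot h (fun t => c * y t) = c * dot h y.
Proof. by rewrite /dot mulr_sumr; apply: eq_bigr => t _; rewrite mulrCA. Qed.

Lemma dotBr h y u : dot h (fun t => y t - u t) = dot h y - dot h u.
Proof. by rewrite /dot -sumrB; apply: eq_bigr => t _; rewrite mulrBr. Qed.

Lemma dot_unit t0 y : dot (fun t => (t == t0)%:R) y = y t0.
Proof.
rewrite /dot (bigD1 t0) //= eqxx mul1r big1 ?addr0 // => t /negbTE ->.
by rewrite mul0r.
Qed.

Lemma dot_coord t0 h : dot h (fun t => (t == t0)%:R) = h t0.
Proof. by rewrite -[RHS](dot_unit t0); apply: eq_bigr => t _; rewrite mulrC. Qed.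

Lemma line0 a b : line a b 0 = a.
Proof. by apply: funext => t; rewrite /line mul0r addr0. Qed.

Lemma line1B a b : line a (fun t => b t - a t) 1 = b.
Proof. by apply: funext => t; rewrite /line mul1r addrC subrK. Qed.

Lemma linepoly_dot y : linepoly 2 (dot^~ y).
Proof.
move=> a b; exists ((dot b y) *: 'X + (dot a y)%:P).
  rewrite -mul_polyC; have := size_MXaddC (dot b y)%:P (dot a y).
  by case: ifP => _ -> //; rewrite ltnS size_polyC; case: eqP.
by move=> s; rewrite dot_line hornerD hornerZ hornerX hornerC addrC mulrC.
Qed.

Lemma linepoly_cst c : linepoly 1 (fun=> c).
Proof. by move=> a b; exists c%:P => [|s]; rewrite ?size_polyC_leq1 ?hornerC. Qed.

Lemma linepolyM D E f g :
  linepoly D f -> linepoly E g -> linepoly (D + E) (fun a => f a * g a).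
Proof.
move=> Hf Hg a b; have [p sp Hp] := Hf a b; have [q sq Hq] := Hg a b.
exists (p * q) => [|s]; last by rewrite hornerM Hp Hq.
by rewrite (leq_trans (size_polyMleq _ _)) // (leq_trans (leq_pred _)) // leq_add.
Qed.

Lemma linepolyB D E f g :
  linepoly D f -> linepoly E g -> linepoly (maxn D E) (fun a => f a - g a).
Proof.
move=> Hf Hg a b; have [p sp Hp] := Hf a b; have [q sq Hq] := Hg a b.
exists (p - q) => [|s]; last by rewrite hornerD hornerN Hp Hq.
rewrite (leq_trans (size_polyD _ _)) // size_polyN geq_max !leq_max sp sq orbT.
by [].
Qed.

Lemma linepoly_prod (I : Type) (r : seq I) (F : I -> (T -> C) -> C) :
  (forall i, exists D, linepoly D (F i)) ->
  exists D, linepoly D (fun a => \prod_(i <- r) F i a).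
Proof.
move=> HF; elim: r => [|i r [D HD]].
  by exists 1%N => a b; exists 1 => [|s]; rewrite ?size_poly1 // big_nil hornerC.
have [E HE] := HF i; exists (E + D)%N.
rewrite (_ : (fun a => _) = fun a => F i a * \prod_(i <- r) F i a).
  exact: linepolyM.
by apply: funext => a; rewrite big_cons.
Qed.

Lemma common_nonzero2 D E f g a b : linepoly D f -> linepoly E g ->
  f a != 0 -> g b != 0 -> exists h, f h != 0 /\ g h != 0.
Proof.
move=> Hf Hg fa gb; pose v := fun t => b t - a t.
have [p _ Hp] := Hf a v; have [q _ Hq] := Hg a v.
have p0 : p != 0.
  by apply: contra_neq fa => p0; rewrite -[a](line0 a v) Hp p0 horner0.
have q0 : q != 0.
  by apply: contra_neq gb => q0; rewrite -(line1B a b) Hq q0 horner0.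
have [j] := exists_nonroot (mulf_neq0 p0 q0) (@mulrIn C _ (oner_neq0 C)).
rewrite hornerM mulf_eq0 negb_or -Hp -Hq => /andP [fj gj].
by exists (line a v j%:R).
Qed.

(** The space is irreducible: the zero sets of finitely many nonzero functions do
    not cover it. *)
Lemma common_nonzero (I : eqType) (r : seq I) (F : I -> (T -> C) -> C) :
  (forall i, exists D, linepoly D (F i)) ->
  (forall i, i \in r -> exists a, F i a != 0) ->
  exists a, forall i, i \in r -> F i a != 0.
Proof.
move=> HF Hne.
suff [a] : exists a, \prod_(i <- r) F i a != 0.
  by rewrite prodf_seq_neq0 => /allP H; exists a.
elim: r Hne => [|i r IH] Hne.
  by exists (fun=> 0); rewrite big_nil oner_neq0.
have [j jr|a Ha] := IH; first by apply: Hne; rewrite inE jr orbT.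
have [b Hb] := Hne i (mem_head _ _).
have [D HD] := HF i; have [E HE] := linepoly_prod r HF.
have [h [h1 h2]] := common_nonzero2 HD HE Hb Ha.
by exists h; rewrite big_cons mulf_neq0.
Qed.

Lemma common_nonzero_dot (I : eqType) (r : seq I) (F : I -> T -> C) :
  (forall i, i \in r -> exists t, F i t != 0) ->
  exists a, forall i, i \in r -> dot a (F i) != 0.
Proof.
move=> HF; apply: (@common_nonzero I r (fun i a => dot a (F i))) => i.
  by exists 2%N; apply: linepoly_dot.
by move=> /HF [t Ht]; exists (fun v => (v == t)%:R); rewrite dot_unit.
Qed.

(** Homogeneity identifies f on the line a + s b with s^m times f on the line
    b + (1/s) a, which bounds the degree in s and gives the leading coefficient. *)
Lemma homogeneous_line D f m a b : linepoly D f ->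
  (forall c h, f (fun t => c * h t) = c ^+ m * f h) ->
  exists p : {poly C}, [/\ (size p <= m.+1)%N, p`_m = f b
                         & forall s, f (line a b s) = p.[s]].
Proof.
move=> Hf Hom; have [p sp Hp] := Hf a b; have [q sq Hq] := Hf b a.
have E s : s != 0 -> p.[s] = s ^+ m * q.[s^-1].
  move=> s0; rewrite -Hp -Hq -Hom; congr f; apply: funext => t.
  by rewrite /line mulrDr mulrA mulfV // mul1r addrC.
have {}sq : (size q <= D.+1)%N by rewrite ltnW.
have Epq : p * 'X^D = 'X^m * reverse_poly D q.
  apply/eqP; rewrite -subr_eq0; set r := _ - _; apply: contraT => r0.
  have [j] := exists_nonroot r0 (fun i j (e : i.+1%:R = j.+1%:R :> C) =>
    succn_inj (mulrIn (oner_neq0 C) e)).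
  have j0 : j.+1%:R != 0 :> C by rewrite pnatr_eq0.
  rewrite /r hornerD hornerN !hornerM !hornerXn (horner_reverse_poly sq) // E //.
  by rewrite -!mulrA [q.[_] * _]mulrC subrr eqxx.
have pE i : p`_i = if (i <= m)%N then q`_(m - i) else 0.
  have := congr1 (fun r : {poly C} => r`_(i + D)) Epq.
  rewrite coefMXn coefXnM ltnNge leq_addl /= addnK => ->.
  case: (leqP i m) => im.
    case: ltnP => Hm; first by rewrite nth_default // (leq_trans sq) //; lia.
    by rewrite coef_poly ltnS ifT; [congr (_`__); lia|lia].
  rewrite ifF; last by apply/negbTE; lia.
  by rewrite coef_poly ifF //; apply/negbTE; lia.
exists p; split=> //.
  by apply/leq_sizeP => j Hj; rewrite pE leqNgt Hj.
by rewrite pE leqnn subnn -horner_coef0 -Hq line0.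
Qed.

End LinePolynomials.

(** * Integer weights that keep finitely many linear forms large *)

Section SmallWeights.
Variable C : numClosedFieldType.

(** If S + w y and S + w' y are both small for two distinct integers, then so are y
    and S; hence each index excludes at most one value of w, and pigeonhole
    applies. *)
Lemma good_coordinate (L : finType) M (S y : L -> C) : (#|L| <= M)%N ->
  exists w : 'I_M.+1, forall l,
    `|y l| <= 2 * `|S l + w%:R * y l| /\ `|S l| <= (2 * M)%:R * `|S l + w%:R * y l|.
Proof.
move=> cL; pose good (w : 'I_M.+1) l := (`|y l| <= 2 * `|S l + w%:R * y l|) &&
  (`|S l| <= (2 * M)%:R * `|S l + w%:R * y l|).
suff [w Hw] : exists w, forall l, good w l.
  by exists w => l; move: (Hw l) => /andP.
have one l (w w' : 'I_M.+1) : w != w' ->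
    `|S l + w%:R * y l| <= `|S l + w'%:R * y l| -> good w' l.
  move=> ww; set u := S l + _; set u' := S l + _ => uu.
  have Ey : (w'%:R - w%:R) * y l = u' - u by rewrite /u /u'; ring.
  have ES : (w'%:R - w%:R) * S l = w'%:R * u - w%:R * u' by rewrite /u /u'; ring.
  have d1 : 1 <= `|w'%:R - w%:R : C|.
    wlog ltw : w w' ww {uu u u' Ey ES} / (w < w')%N => [H|].
      have [lw|lw|ew] := ltngtP w w'; first exact: H.
        by rewrite distrC; apply: H; rewrite // eq_sym.
      by rewrite (val_inj ew) eqxx in ww.
    by rewrite -natrB 1?ltnW // normr_nat ler1n subn_gt0.
  have up (z : C) : `|z| <= `|(w'%:R - w%:R) * z| by rewrite normrM ler_peMl.
  apply/andP; split.
    apply: le_trans (up _) _; rewrite Ey (le_trans (ler_normB _ _)) //.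
    by rewrite mulr_natl mulr2n lerD2l.
  have wM (v : 'I_M.+1) : v%:R <= M%:R :> C by rewrite ler_nat -ltnS.
  apply: le_trans (up _) _; rewrite ES (le_trans (ler_normB _ _)) //.
  rewrite !normrM !normr_nat mulnC natrM -mulrA [2%:R * _]mulr_natl mulr2n mulrDr.
  by rewrite lerD // ler_pM ?ler0n ?normr_ge0.
apply: contrapT => H.
have {}H (w : 'I_M.+1) : exists l, ~~ good w l.
  apply: contrapT => Hw; apply: H; exists w => l.
  by apply: contraT => Hl; case: Hw; exists l.
have [bad Hbad] := choice H.
have /leq_card : injective bad.
  move=> w w' E; apply/eqP; apply: contraT => ww.
  have nr (z : C) : `|z| \is Num.real by rewrite normr_real.
  case: (real_leP (nr (S (bad w) + w%:R * y (bad w)))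
                  (nr (S (bad w) + w'%:R * y (bad w)))) => [|/ltW] Hle.
    by move: (Hbad w'); rewrite -E (one _ _ _ ww Hle).
  by move: (Hbad w); rewrite (one _ w' w) // eq_sym.
by rewrite card_ord leqNgt ltnS cL.
Qed.

(** Elementary substitute for Jensen's formula: one integral vector of weights
    0..M makes every one of at most M linear forms as large as its largest
    coordinate, up to a factor polynomial in M. *)
Lemma good_weights (T L : finType) M (y : L -> T -> C) :
  (0 < M)%N -> (#|L| <= M)%N ->
  exists w : T -> 'I_M.+1, forall l t,
    `|y l t| <= (2 * M)%:R ^+ #|T| * `|\sum_u (w u)%:R * y l u|.
Proof.
move=> M0 cL.
suff H (s : seq T) : uniq s -> exists w : T -> 'I_M.+1, forall l t, t \in s ->
    `|y l t| <= (2 * M)%:R ^+ size s * `|\sum_(u <- s) (w u)%:R * y l u|.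
  have [w Hw] := H _ (enum_uniq T); exists w => l t.
  by have := Hw l t (mem_enum _ _); rewrite -cardE big_enum.
elim: s => [_|t0 s IH /= /andP [t0s us]]; first by exists (fun=> ord0).
have [w Hw] := IH us.
have [w0 Hw0] := good_coordinate (fun l => \sum_(u <- s) (w u)%:R * y l u)
  (fun l => y l t0) cL.
pose w' t := if t == t0 then w0 else w t.
have Ew' l : \sum_(u <- t0 :: s) (w' u)%:R * y l u =
    \sum_(u <- s) (w u)%:R * y l u + w0%:R * y l t0.
  rewrite big_cons /w' eqxx addrC; congr (_ + _).
  rewrite !big_seq; apply: eq_bigr => u us'.
  by case: eqP => // ut; rewrite ut (negbTE t0s) in us'.
have M1 : 1 <= (2 * M)%:R :> C by rewrite ler1n muln_gt0.
exists w' => l t; rewrite Ew' inE => /orP [/eqP ->|ts].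
  have [H _] := Hw0 l; apply: le_trans H _; rewrite ler_wpM2r //.
  apply: (@le_trans _ _ (2 * M)%:R); first by rewrite ler_nat leq_pmulr.
  by rewrite ler_eXnr.
have [_ H] := Hw0 l; apply: le_trans (Hw l t ts) _.
by rewrite exprSr -mulrA ler_wpM2l // exprn_ge0 // ler0n.
Qed.

End SmallWeights.

(** * Splitting into linear forms *)

Section Splitting.
Variables (C : numClosedFieldType) (T : finType).
Variables (f : (T -> C) -> C) (D M : nat) (g : T -> C) (Y : (T -> C) -> Prop).
Hypothesis f_poly : linepoly D f.
Hypothesis f_homog : forall c h, f (fun t => c * h t) = c ^+ M * f h.
Hypothesis fg : f g != 0.
Hypothesis f_vanish : forall y h, Y y -> dot h y = 0 -> f h = 0.

Let normalized (z : {ffun T -> C}) :=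
  exists2 y, Y y & forall t, y t = dot g y * z t.

Let dot_g y : Y y -> dot g y != 0.
Proof. by move=> Yy; apply: contra_neq fg => /(f_vanish Yy). Qed.

Let normalize y : Y y -> exists2 z, normalized z & forall h, dot h y = dot g y * dot h z.
Proof.
move=> Yy; have E t : y t = dot g y * [ffun u => y u / dot g y] t.
  by rewrite ffunE mulrC divfK // dot_g.
exists [ffun u => y u / dot g y]; first by exists y.
by move=> h; rewrite -dotZr; congr dot; apply: funext.
Qed.

Let normalized1 z : normalized z -> dot g z = 1.
Proof.
move=> [y Yy E]; apply: (mulfI (dot_g Yy)); rewrite mulr1 -dotZr.
by congr dot; apply: funext => t; rewrite -E.
Qed.

Let normalized_vanish z h : normalized z -> dot h z = 0 -> f h = 0.
Proof.
move=> [y Yy E] hz; apply: (f_vanish Yy).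
by rewrite (_ : y = fun t => dot g y * z t) ?dotZr ?hz ?mulr0 //; apply: funext.
Qed.

(* Distinct normalized vectors give distinct roots on a generic line of
   direction [g], so there are at most M of them. *)
Let normalized_bound (s : seq {ffun T -> C}) :
  uniq s -> (forall z, z \in s -> normalized z) -> (size s <= M)%N.
Proof.
move=> us Hs.
pose r := [seq p <- [seq (z, z') | z <- s, z' <- s] | p.1 != p.2].
have [p|a Ha] := @common_nonzero_dot C T _ r (fun p t => p.1 t - p.2 t).
  rewrite mem_filter => /andP [zz _]; apply: contrapT => H; case/eqP: zz.
  apply/ffunP => t; apply/eqP; rewrite -subr_eq0; apply: contraT => Ht.
  by case: H; exists t.
have [p [sp pM Hp]] := homogeneous_line a g f_poly f_homog.
have p0 : p != 0 by apply: contra_neq fg => p0; rewrite -pM p0 coef0.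
have := @max_poly_roots _ p [seq - dot a z | z : {ffun T -> C} <- s] p0.
rewrite size_map => H; rewrite -ltnS (leq_trans _ sp) //; apply: H.
  apply/allP => x /mapP [z zs ->]; rewrite /root -Hp; apply/eqP.
  apply: (normalized_vanish (Hs z zs)).
  by rewrite dot_line normalized1 ?mulr1 ?subrr //; apply: Hs.
rewrite map_inj_in_uniq // => z z' zs zs' /oppr_inj E; apply/eqP.
apply: contraT => zz; have /Ha : (z, z') \in r.
  by rewrite mem_filter zz; apply/allpairsP; exists (z, z').
by rewrite /= dotBr E subrr eqxx.
Qed.

Let normalized_finite : exists s : seq {ffun T -> C},
  (forall z, z \in s -> normalized z) /\ forall z, normalized z -> z \in s.
Proof.
apply: contrapT => H.
have [s [us ss Hs]] : exists s : seq {ffun T -> C},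
    [/\ uniq s, size s = M.+1 & forall z, z \in s -> normalized z].
  elim: M.+1 => [|k [s [us ss Hs]]]; first by exists [::].
  apply: contrapT => Hk; apply: H; exists s; split=> // z Hz.
  apply: contraT => zs; case: Hk; exists (z :: s); rewrite /= zs ss; split=> //.
  by move=> z'; rewrite inE => /orP [/eqP ->|/Hs].
by have := normalized_bound us Hs; rewrite ss ltnn.
Qed.

Variables (I : finType) (u u' : I -> T -> C).
Hypothesis u_indep : forall i c c',
  (forall t, c * u i t + c' * u' i t = 0) -> c = 0 /\ c' = 0.
Hypothesis f_zero : forall h, f h = 0 ->
  (exists2 y, Y y & dot h y = 0) \/ exists i, dot h (u i) = 0 /\ dot h (u' i) = 0.

(** If the zero set of a homogeneous polynomial function [f] is a union of
    hyperplanes, up to finitely many subspaces of codimension 2, then [f] is a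
    product of the corresponding linear forms. A generic line of direction [g]
    avoids the exceptional subspaces, so [f] splits over it; this makes [f]
    locally one of finitely many products, hence globally one of them, by
    irreducibility of the space. *)
Theorem splitting : exists c, exists y : 'I_M -> T -> C,
  (forall l, Y (y l)) /\ forall h, f h = c * \prod_l dot h (y l).
Proof.
have [s [Hs sN]] := normalized_finite.
pose v i t := dot g (u' i) * u i t - dot g (u i) * u' i t.
pose w i := if [exists t, v i t != 0] then v i else u i.
have w0 i : exists t, w i t != 0.
  rewrite /w; case: existsP => // Hv; apply: contrapT => Hu.
  have Hz t : 1 * u i t + 0 * u' i t = 0.
    rewrite mul1r mul0r addr0; apply/eqP; apply: contraT => Ht.
    by case: Hu; exists t.
  by have [/eqP] := u_indep Hz; rewrite oner_eq0.
have roots a : (forall i, dot a (w i) != 0) ->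
    forall x, f (line a g x) = 0 -> exists2 z : {ffun T -> C}, z \in s & - x = dot a z.
  move=> Ha x /f_zero [[y Yy]|[i [E E']]].
    have [z Nz ->] := normalize Yy; rewrite dot_line (normalized1 Nz) mulr1.
    move=> /eqP; rewrite mulf_eq0 (negbTE (dot_g Yy)) addr_eq0 => /eqP E.
    by exists z; [apply: sN|rewrite E].
  move: (Ha i); rewrite /w; case: existsP => Hv; case/eqP; move: E E'.
    rewrite !dot_line => /eqP; rewrite addr_eq0 => /eqP E.
    move=> /eqP; rewrite addr_eq0 => /eqP E'.
    by rewrite /v dotBr !dotZr E E'; ring.
  have [//|g' gu] := @u_indep i (dot g (u' i)) (- dot g (u i)).
    move=> t; rewrite mulNr; apply/eqP; apply: contraT => Ht.
    by case: Hv; exists t.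
  by move: gu => /eqP; rewrite oppr_eq0 dot_line => /eqP ->; rewrite mulr0 addr0.
pose N := size s.
pose z0 : {ffun T -> C} := [ffun=> 0].
pose F (k : {ffun 'I_M -> 'I_N} + I) a := match k with
  | inl e => f a - f g * \prod_l dot a (nth z0 s (e l)) | inr i => dot a (w i) end.
have [e He] : exists e : {ffun 'I_M -> 'I_N},
    forall a, f a = f g * \prod_l dot a (nth z0 s (e l)).
  apply: contrapT => H.
  have [k|k _|a Ha] := @common_nonzero C T _ (index_enum _) F.
  - case: k => [e|i]; last by exists 2%N; apply: linepoly_dot.
    have [E HE] := @linepoly_prod C T _ (index_enum _)
      (fun l a => dot a (nth z0 s (e l))) (fun l => ex_intro _ 2%N (linepoly_dot _)).
    by exists (maxn D (1 + E)); exact: (linepolyB f_poly (linepolyM (linepoly_cst _) HE)).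
  - case: k => [e|i]; last first.
      by have [t Ht] := w0 i; exists (fun x => (x == t)%:R); rewrite /= dot_unit.
    apply: contrapT => He; apply: H; exists e => a; apply/eqP.
    by rewrite -subr_eq0; apply: contraT => Ha; case: He; exists a.
  have Ha' i : dot a (w i) != 0 by apply: (Ha (inr i)); apply: mem_index_enum.
  have [p [sp pM Hp]] := homogeneous_line a g f_poly f_homog.
  have szp : size p = M.+1.
    by apply/eqP; rewrite eqn_leq sp ltnNge; apply: contra fg => H';
       rewrite -pM nth_default.
  have [r Er] := closed_field_poly_normal p.
  have pl : lead_coef p = f g by rewrite /lead_coef szp.
  have sr : size r = M.
    have := congr1 (fun q : {poly C} => size q) Er.
    by rewrite szp size_scale ?pl // size_prod_XsubC => -[].
  have rx (l : 'I_M) : exists j : 'I_N, - r`_l = dot a (nth z0 s j).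
    have [|z zs ->] := roots a Ha' r`_l.
      rewrite Hp; apply/eqP; rewrite Er -/(root _ _) rootZ ?pl //.
      by rewrite root_prod_XsubC mem_nth // sr.
    by exists (Ordinal (etrans (index_mem z s) zs)); rewrite /= nth_index.
  have [j Hj] := choice rx.
  have /(_ (mem_index_enum _)) := Ha (inl (finfun j)); case/eqP => /=.
  apply/eqP; rewrite subr_eq0; apply/eqP; rewrite -{1}(line0 a g) Hp Er hornerZ pl.
  rewrite horner_prod (big_nth 0) big_mkord sr; congr (_ * _).
  by apply: eq_bigr => l _; rewrite ffunE -Hj hornerXsubC sub0r.
have [y Hy] : exists y : 'I_M -> T -> C, forall l,
    Y (y l) /\ forall h, dot h (y l) = dot g (y l) * dot h (nth z0 s (e l)).
  suff /choice [y Hy] : forall l, exists y, Y y /\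
      forall h, dot h y = dot g y * dot h (nth z0 s (e l)) by exists y.
  move=> l; have [y Yy E] := Hs _ (mem_nth z0 (ltn_ord (e l))).
  by exists y; split => // h; rewrite -dotZr; congr dot; apply: funext.
exists (f g / \prod_l dot g (y l)); exists y; split=> [l|h]; first by case: (Hy l).
rewrite He (eq_bigr _ (fun l _ => (Hy l).2 h)) big_split /= mulrA divfK //.
by apply/prodf_neq0 => l _; apply: dot_g; case: (Hy l).
Qed.

End Splitting.

(** * Symmetric expressions in the factors of a split form *)

Section Newton.
Variable C : numClosedFieldType.
Implicit Types (x : C) (s : seq C).

Definition linprod s : {poly C} := \prod_(x <- s) (1 + x *: 'X).

Lemma linprod_cons x s k : (linprod (x :: s))`_k.+1 = (linprod s)`_k.+1 + x * (linprod s)`_k.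
Proof. by rewrite /linprod big_cons mulrDl mul1r coefD -scalerAl coefZ coefXM. Qed.

Lemma linprod0 s : (linprod s)`_0 = 1.
Proof.
elim: s => [|x s IH]; first by rewrite /linprod big_nil coef1.
by rewrite /linprod big_cons mulrDl mul1r coefD -scalerAl coefZ coefXM mulr0 addr0.
Qed.

Lemma size_linprod s : (size (linprod s) <= (size s).+1)%N.
Proof.
elim: s => [|x s IH]; first by rewrite /linprod big_nil size_poly1.
rewrite /linprod big_cons (leq_trans (size_polyMleq _ _)) //.
have : (size (1 + x *: 'X : {poly C})%R <= 2)%N.
  rewrite (leq_trans (size_polyD _ _)) // geq_max size_poly1 /=.
  by rewrite (leq_trans (size_scale_leq _ _)) // size_polyX.
by move=> s2; rewrite -subn1 leq_subLR; apply: leq_trans (leq_add s2 IH) _.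
Qed.

Lemma linprod_last s : (linprod s)`_(size s) = \prod_(x <- s) x.
Proof.
elim: s => [|x s IH]; first by rewrite /linprod !big_nil coef1.
by rewrite /= linprod_cons IH big_cons nth_default ?add0r // size_linprod.
Qed.

(** Newton's identity between elementary symmetric functions and power sums, by
    induction on the sequence: adjoining [x] adds a telescoping sum. *)
Lemma newton_identity s k : k.+1%:R * (linprod s)`_k.+1 =
  \sum_(i < k.+1) (-1) ^+ i * (linprod s)`_(k - i) * \sum_(x <- s) x ^+ i.+1.
Proof.
elim: s k => [|x s IH] k.
  rewrite /linprod big_nil coef1 mulr0 big1 // => i _.
  by rewrite big_nil mulr0.
have tel j : \sum_(i < j.+1) (-1) ^+ i * (linprod (x :: s))`_(j - i) * x ^+ i.+1 =
    x * (linprod s)`_j.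
  elim: j => [|j IHj].
    by rewrite big_ord_recl big_ord0 addr0 subn0 !linprod0; ring.
  rewrite big_ord_recl /= subn0 linprod_cons.
  under eq_bigr => i _.
    rewrite /bump /= add1n subSS exprS (exprS x).
    rewrite (_ : _ * _ * _ = - x * ((-1) ^+ i * (linprod (x :: s))`_(j - i) * x ^+ i.+1)); last by ring.
    over.
  by rewrite -mulr_sumr IHj; ring.
under eq_bigr => i _ do rewrite big_cons mulrDr.
rewrite big_split /= tel linprod_cons mulrDr.
have -> : \sum_(i < k.+1) (-1) ^+ i * (linprod (x :: s))`_(k - i) * (\sum_(z <- s) z ^+ i.+1) =
    k.+1%:R * (linprod s)`_k.+1 + x * (k%:R * (linprod s)`_k); last by ring.
case: k => [|k].
  by rewrite IH !big_ord_recl !big_ord0 /= !subn0 !linprod0; ring.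
rewrite big_ord_recr /= subnn linprod0.
under eq_bigr => i _.
  rewrite subSn -1?ltnS // linprod_cons -subSn -1?ltnS //.
  rewrite mulrDr mulrDl mulrA -[_ * x * _]mulrA [_ * (x * _)]mulrCA -[x * _ * _]mulrA.
  over.
rewrite big_split /= -mulr_sumr -IH addrAC; congr (_ + _).
by rewrite IH [in RHS]big_ord_recr /= subnn linprod0.
Qed.

End Newton.

Section Multisymmetric.
Variables (C : numClosedFieldType) (S : Type) (A : (S -> C) -> Prop).
Hypothesis A_cst : forall c, A (fun=> c).
Hypothesis A_add : forall f g, A f -> A g -> A (fun s => f s + g s).
Hypothesis A_mul : forall f g, A f -> A g -> A (fun s => f s * g s).

Let A_ext f g : A f -> f =1 g -> A g.
Proof. by move=> Af /funext <-. Qed.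

Let A_sum (I : Type) (r : seq I) (F : I -> S -> C) :
  (forall i, A (F i)) -> A (fun s => \sum_(i <- r) F i s).
Proof.
move=> HF; elim: r => [|i r IH].
  by apply: A_ext (A_cst 0) _ => s; rewrite big_nil.
by apply: A_ext (A_add (HF i) IH) _ => s; rewrite big_cons.
Qed.

Let A_prod (I : Type) (r : seq I) (F : I -> S -> C) :
  (forall i, A (F i)) -> A (fun s => \prod_(i <- r) F i s).
Proof.
move=> HF; elim: r => [|i r IH].
  by apply: A_ext (A_cst 1) _ => s; rewrite big_nil.
by apply: A_ext (A_mul (HF i) IH) _ => s; rewrite big_cons.
Qed.

Let A_coef (q : S -> {poly C}) d r : (forall s, (size (q s) <= d)%N) ->
  (forall x, A (fun s => (q s).[x])) -> A (fun s => (q s)`_r).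
Proof.
move=> sq Hq; have [w Hw] := coef_interpolation C d r.
apply: A_ext (A_sum (index_enum _) (fun i => A_mul (A_cst (w i)) (Hq (val i)%:R))) _.
by move=> s; rewrite (Hw _ (sq s)).
Qed.

Let A_power_sums (v : S -> seq C) : (forall k, A (fun s => (linprod (v s))`_k)) ->
  forall k, A (fun s => \sum_(x <- v s) x ^+ k.+1).
Proof.
move=> Hv k; have [n] := ubnP k; elim: n k => // n IH k Hk.
pose lower s := \sum_(i < k) (-1) ^+ i * (linprod (v s))`_(k - i) * \sum_(x <- v s) x ^+ i.+1.
have Hl : A lower.
  apply: A_sum => i; apply: A_mul; first by apply: A_mul.
  by apply: IH; apply: leq_trans (ltn_ord i) _.
apply: A_ext (A_mul (A_cst ((-1) ^+ k)) (A_add (A_mul (A_cst k.+1%:R) (Hv k.+1))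
  (A_mul (A_cst (-1)) Hl))) _ => s.
rewrite newton_identity big_ord_recr /= -/(lower s) subnn linprod0.
by rewrite mulN1r [lower s + _]addrC addrK mulr1 mulrA -expr2 sqrr_sign mul1r.
Qed.

Let A_total_product (v : S -> seq C) m : (forall s, size (v s) = m) ->
  (forall k, A (fun s => \sum_(x <- v s) x ^+ k.+1)) ->
  A (fun s => \prod_(x <- v s) x).
Proof.
move=> sv Hv; suff H k : A (fun s => (linprod (v s))`_k).
  by apply: A_ext (H m) _ => s; rewrite -(sv s) linprod_last.
have [n] := ubnP k; elim: n k => // n IH [_|k Hk].
  by apply: A_ext (A_cst 1) _ => s; rewrite linprod0.
pose F (i : 'I_k.+1) s := (-1) ^+ i * (linprod (v s))`_(k - i) * \sum_(x <- v s) x ^+ i.+1.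
have HF i : A (F i).
  apply: A_mul => //; apply: A_mul => //; apply: IH.
  by rewrite (leq_ltn_trans (leq_subr _ _)).
apply: A_ext (A_mul (A_cst k.+1%:R^-1) (A_sum (index_enum _) HF)) _ => s.
by rewrite /F -newton_identity mulrA mulVf ?mul1r // pnatr_eq0.
Qed.

Let coef1_affineX (b c : C) k : ((b%:P + c *: 'X) ^+ k.+1)`_1 = k.+1%:R * b ^+ k * c.
Proof.
have E0 j : ((b%:P + c *: 'X) ^+ j)`_0 = b ^+ j.
  by rewrite -horner_coef0 hornerE hornerD hornerC hornerZ hornerX mulr0 addr0.
elim: k => [|k IH]; first by rewrite expr1 coefD coefC coefZ coefX /=; ring.
rewrite exprS mulrDl coefD coefCM IH -scalerAl coefZ coefXM /= E0.
by rewrite exprS -[k.+2%:R]natr1; ring.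
Qed.

Variables (T : finType) (m : nat) (y : S -> 'I_m -> T -> C) (e : T -> C).
Hypothesis y_prod : forall h, A (fun s => \prod_l dot h (y s l)).
Hypothesis y_norm : forall s l, dot e (y s l) = 1.

Let size_ord : size (index_enum 'I_m) = m.
Proof. by rewrite -sum1_size big_const_ord iter_addn_0 mul1n. Qed.

Let A_linear_power_sums b k : A (fun s => \sum_l dot b (y s l) ^+ k.+1).
Proof.
have H s (F : C -> C) : \sum_l F (dot b (y s l)) =
    \sum_(x <- [seq dot b (y s l) | l <- index_enum 'I_m]) F x by rewrite big_map.
rewrite (_ : (fun s => _) = fun s => \sum_(x <- [seq dot b (y s l) | l <- index_enum 'I_m]) x ^+ k.+1); last by apply: funext => s; rewrite (H s (fun x => x ^+ k.+1)).
apply: A_power_sums => j; apply: (@A_coef _ m.+1) => [s|x].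
  by rewrite (leq_trans (size_linprod _)) // size_map size_ord.
apply: A_ext (y_prod (line e b x)) _ => s; rewrite /linprod big_map horner_prod.
by apply: eq_bigr => l _; rewrite dot_line y_norm hornerD hornerC hornerZ hornerX mulrC.
Qed.

(* Polarization: the linear coefficient in X of (b + X c)^(k+1) is (k+1) b^k c. *)
Let A_polarized bs b k :
  A (fun s => \sum_l dot b (y s l) ^+ k.+1 * \prod_(c <- bs) dot c (y s l)).
Proof.
elim: bs b k => [|c bs IH] b k.
  apply: A_ext (A_linear_power_sums b k) _ => s.
  by apply: eq_bigr => l _; rewrite big_nil mulr1.
pose q s := \sum_l (\prod_(c <- bs) dot c (y s l)) *:
  ((dot b (y s l))%:P + dot c (y s l) *: 'X) ^+ k.+2.
have Hq : A (fun s => (q s)`_1).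
  apply: (@A_coef _ k.+3) => [s|x].
    rewrite (leq_trans (size_sum _ _ _)) //; apply/bigmax_leqP => l _.
    rewrite (leq_trans (size_scale_leq _ _)) // (leq_trans (size_poly_exp_leq _ _)) //.
    have : (size ((dot b (y s l))%:P + dot c (y s l) *: 'X)%R <= 2)%N.
      rewrite (leq_trans (size_polyD _ _)) // geq_max.
      rewrite (leq_trans (size_polyC_leq1 _)) //=.
      by rewrite (leq_trans (size_scale_leq _ _)) // size_polyX.
    by case: size => [|[|[|]]] //= _; rewrite ?mul0n ?mul1n.
  apply: A_ext (IH (line b c x) k.+1) _ => s.
  rewrite horner_sum; apply: eq_bigr => l _.
  by rewrite hornerZ horner_exp hornerD hornerC hornerZ hornerX dot_line mulrC [_ * x]mulrC.
apply: A_ext (A_mul (A_cst k.+2%:R^-1) Hq) _ => s.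
rewrite coef_sum mulr_sumr; apply: eq_bigr => l _.
rewrite coefZ coef1_affineX big_cons.
rewrite (_ : _ * _ = k.+2%:R^-1 * k.+2%:R * (dot b (y s l) ^+ k.+1 *
  (dot c (y s l) * \prod_(j <- bs) dot j (y s l)))); last by ring.
by rewrite mulVf ?mul1r // pnatr_eq0.
Qed.

(** The product over l of sum_t a_t y_l(t)^k depends only on the form
    h |-> prod_l h(y_l), through finitely many of its values and without any
    choice of the y_l. This is expressed by an arbitrary algebra [A] of functions
    of a parameter: rational functions give regularity in the parameter, and
    functions on two points taking equal values give uniqueness. The steps are:
    power sums of each linear form by Newton's identities, power sums of all
    monomials by polarization, then the product by Newton's identities again. *)
Lemma multisymmetric k (a : T -> S -> C) : (forall t, A (a t)) ->
  A (fun s => \prod_l \sum_t a t s * y s l t ^+ k).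
Proof.
move=> Ha; pose u s l := \sum_t a t s * y s l t ^+ k.
rewrite (_ : (fun s => _) =
  fun s => \prod_(x <- [seq u s l | l <- index_enum 'I_m]) x); last first.
  by apply: funext => s; rewrite big_map.
apply: (@A_total_product _ m) => [s|r].
  by rewrite size_map size_ord.
pose G (f : {ffun 'I_r.+1 -> T}) s := (\prod_i a (f i) s) * \sum_l \prod_i y s l (f i) ^+ k.
have HG f : A (G f).
  apply: A_mul; first by apply: A_prod.
  pose unit t : T -> C := fun v => (v == t)%:R.
  pose bs := flatten [seq nseq k (unit (f i)) | i <- index_enum 'I_r.+1].
  apply: A_ext (A_polarized bs e 0) _ => s; apply: eq_bigr => l _.
  rewrite y_norm expr1n mul1r /bs big_flatten big_map; apply: eq_bigr => i _.
  by rewrite big_nseq dot_unit -Monoid.iteropE.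
apply: A_ext (A_sum (index_enum _) HG) _ => s.
transitivity (\sum_(f : {ffun 'I_r.+1 -> T}) \sum_l
    (\prod_i a (f i) s) * \prod_i y s l (f i) ^+ k).
  by apply: eq_bigr => f _; rewrite /G mulr_sumr.
rewrite big_map exchange_big /=; apply: eq_bigr => l _.
have -> : u s l ^+ r.+1 = \prod_(i < r.+1) u s l by rewrite prodr_const card_ord.
rewrite /u bigA_distr_bigA /=; apply: eq_bigr => f _.
by rewrite -big_split.
Qed.

End Multisymmetric.

(** * The power transform of a split form *)

Section PowerTransform.
Variables (C : numClosedFieldType) (T : finType).
Implicit Types (a h e y : T -> C).

Definition pow k y : T -> C := fun t => y t ^+ k.

(** The vectors y_l may be rescaled to have value 1 at [e], the scalars being
    absorbed in the value of the form at [e]. *)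
Lemma pow_normalize k m (c : C) (y : 'I_m -> T -> C) a e :
  (forall l, dot e (y l) != 0) ->
  c ^+ k * \prod_l dot a (pow k (y l)) =
  (c * \prod_l dot e (y l)) ^+ k *
  \prod_l dot a (pow k (fun t => (dot e (y l))^-1 * y l t)).
Proof.
move=> He; rewrite exprMn -mulrA -prodrXl -big_split /=; congr (_ * _).
apply: eq_bigr => l _; rewrite -dotZr; congr dot; apply: funext => t.
by rewrite /pow exprMn mulrA -exprMn mulfV // expr1n mul1r.
Qed.

Lemma split_normalize m (c : C) (y : 'I_m -> T -> C) h e : c != 0 ->
  (forall l, dot e (y l) != 0) ->
  \prod_l dot h (fun t => (dot e (y l))^-1 * y l t) =
  (c * \prod_l dot h (y l)) / (c * \prod_l dot e (y l)).
Proof.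
move=> c0 He; rewrite (eq_bigr _ (fun l _ => dotZr _ _ _)) big_split /= prodfV.
by rewrite -mulf_div divff // mul1r mulrC.
Qed.

Lemma split_form_nonzero m (c : C) (y : 'I_m -> T -> C) :
  (forall l, exists t, y l t != 0) -> c != 0 ->
  exists e, c * \prod_l dot e (y l) != 0.
Proof.
move=> Hy c0; have [//|e He] := @common_nonzero_dot C T _ (index_enum 'I_m) y.
exists e; rewrite mulf_neq0 //; apply/prodf_neq0 => l _.
by apply: He; apply: mem_index_enum.
Qed.

(** Two factorizations of one form have the same power transform: apply the
    multisymmetric expression with S = bool and A the functions taking the same
    value at both points. *)
Lemma power_transform_unique k m (c c' : C) (y y' : 'I_m -> T -> C) a :
  (0 < k)%N ->
  (forall l, exists t, y l t != 0) -> (forall l, exists t, y' l t != 0) ->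
  (forall h, c * \prod_l dot h (y l) = c' * \prod_l dot h (y' l)) ->
  c ^+ k * \prod_l dot a (pow k (y l)) = c' ^+ k * \prod_l dot a (pow k (y' l)).
Proof.
move=> k0 Hy Hy' E.
have [c0|c0] := eqVneq c 0.
  have [->|c'0] := eqVneq c' 0; first by rewrite c0 expr0n eqn0Ngt k0 !mul0r.
  by have [e] := split_form_nonzero Hy' c'0; rewrite -E c0 mul0r eqxx.
have [e He] := split_form_nonzero Hy c0.
have ye l : dot e (y l) != 0.
  by move: He; rewrite mulf_eq0 negb_or => /andP [_ /prodf_neq0]; apply.
have y'e l : dot e (y' l) != 0.
  by move: He; rewrite E mulf_eq0 negb_or => /andP [_ /prodf_neq0]; apply.
rewrite (pow_normalize _ _ _ ye) (pow_normalize _ _ _ y'e) E; congr (_ * _).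
have c'0 : c' != 0 by move: He; rewrite E mulf_eq0 negb_or => /andP [].
pose z (b : bool) l t :=
  if b then (dot e (y l))^-1 * y l t else (dot e (y' l))^-1 * y' l t.
pose A (g : bool -> C) := g true = g false.
have Ac x : A (fun=> x) by [].
have Aa g g' : A g -> A g' -> A (fun s => g s + g' s) by rewrite /A => -> ->.
have Am g g' : A g -> A g' -> A (fun s => g s * g' s) by rewrite /A => -> ->.
apply: (@multisymmetric C bool A Ac Aa Am T m z e _ _ k (fun t _ => a t)) => //.
  by move=> h; rewrite /A /z (split_normalize h c0 ye) (split_normalize h c'0 y'e) !E.
by move=> [] l; rewrite /z dotZr mulVf.
Qed.

Variables (k m D : nat) (p : C -> (T -> C) -> C) (f : C -> C) (a b : T -> C).
Hypothesis k_gt0 : (0 < k)%N.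
Hypothesis p_poly : forall h,
  exists2 q : {poly C}, (size q <= D)%N & forall s, p s h = q.[s].
Hypothesis pf : forall s, exists c, exists y : 'I_m -> T -> C,
  [/\ forall l, exists t, y l t != 0, forall h, p s h = c * \prod_l dot h (y l)
    & f s = c ^+ k * \prod_l dot (line a b s) (pow k (y l))].

Let weights := {ffun T -> 'I_m.+2}.
Let vec (w : weights) : T -> C := fun t => (w t)%:R.
Let N : C := \sum_t (`|a t| + `|b t|).
Let G : C := (2 * m.+1)%:R ^+ #|T|.

Let f_bound s : exists w : weights,
  `|f s| <= (N * G ^+ k) ^+ m * (1 + `|s|) ^+ m * `|p s (vec w)| ^+ k.
Proof.
have [c [y [_ Hp ->]]] := pf s.
have [|w Hw] := @good_weights C T 'I_m m.+1 y (ltn0Sn m); first by rewrite card_ord.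
exists (finfun w); have {}Hw l t : `|y l t| <= G * `|dot (vec (finfun w)) (y l)|.
  rewrite (_ : dot _ _ = \sum_u (w u)%:R * y l u) //.
  by apply: eq_bigr => u _; rewrite /vec ffunE.
have -> : (N * G ^+ k) ^+ m * (1 + `|s|) ^+ m =
    \prod_(l < m) (N * G ^+ k * (1 + `|s|)) by rewrite -exprMn prodr_const card_ord.
rewrite Hp !normrM normrX exprMn mulrCA ler_wpM2l ?exprn_ge0 //.
rewrite !normr_prod -prodrXl.
rewrite -big_split /=; apply: ler_prod => l _; rewrite normr_ge0 /=.
apply: le_trans (ler_norm_sum _ _ _) _.
have -> : N * G ^+ k * (1 + `|s|) * `|dot (vec (finfun w)) (y l)| ^+ k =
    \sum_t (1 + `|s|) * (`|a t| + `|b t|) * (G ^+ k * `|dot (vec (finfun w)) (y l)| ^+ k).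
  by rewrite -mulr_suml -mulr_sumr -/N; ring.
apply: ler_sum => t _; rewrite normrM /pow normrX /line.
have H1 : `|y l t| ^+ k <= G ^+ k * `|dot (vec (finfun w)) (y l)| ^+ k.
  by rewrite -exprMn lerXn2r ?nnegrE // mulr_ge0 // exprn_ge0 // ler0n.
have H2 : `|a t + s * b t| <= (1 + `|s|) * (`|a t| + `|b t|).
  apply: le_trans (ler_normD _ _) _; rewrite normrM mulrDl mul1r mulrDr.
  by rewrite -addrA lerD2l addrA lerDr addr_ge0 // mulr_ge0.
exact: ler_pM (normr_ge0 _) (exprn_ge0 _ (normr_ge0 _)) H2 H1.
Qed.

Let R_of (q : weights -> {poly C}) (i : weights * 'I_m.+1) : {poly C} :=
  ((N * G ^+ k) ^+ m * 'C(m, i.2)%:R) *: ('X^(i.2) * q i.1 ^+ k).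


Let f_dominated q : (forall w s, p s (vec w) = (q w).[s]) ->
  forall s, `|f s| <= \sum_i `|(R_of q i).[s]|.
Proof.
move=> Hq s; have [w Hw] := f_bound s; apply: le_trans Hw _.
have N0 : 0 <= N by apply: sumr_ge0 => t _; rewrite addr_ge0.
have G0 : 0 <= G by rewrite exprn_ge0 // ler0n.
have K0 : 0 <= (N * G ^+ k) ^+ m by rewrite exprn_ge0 // mulr_ge0 // exprn_ge0.
rewrite /R_of; set K := (N * G ^+ k) ^+ m in K0 *; clearbody K.
rewrite -(@pair_bigA _ _ _ _ _ (fun (w : weights) (j : 'I_m.+1) => `|((K * 'C(m, j)%:R) *: ('X^j * q w ^+ k)).[s]|)) (bigD1 w) //=.
rewrite -[leLHS]addr0 lerD //; last by do 2!apply: sumr_ge0 => ? _.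
rewrite exprDn mulr_sumr mulr_suml; apply: ler_sum => j _.
rewrite hornerZ hornerM hornerXn horner_exp -Hq !normrM !normrX expr1n mul1r.
by rewrite (ger0_norm K0) normr_nat -mulr_natr le_eqVlt; apply/orP; left; apply/eqP; ring.
Qed.

(* Where the form does not vanish at [e], [f] is rational with a power of its
   value at [e] as denominator; being dominated by polynomials, it has no pole. *)
Let f_poly_off e q : (forall s, p s e = q.[s]) -> q != 0 ->
  exists Q : {poly C}, forall s, q.[s] != 0 -> f s = Q.[s].
Proof.
move=> Hq q0; have [Y HY] := choice pf; have {HY}[y Hy] := choice HY.
pose S := {s : C | q.[s] != 0}.
pose A (g : S -> C) := exists A0 : {poly C}, exists E,
  forall s : S, g s * q.[val s] ^+ E = A0.[val s].
have Ac c : A (fun=> c) by exists c%:P, 0%N => s; rewrite expr0 mulr1 hornerC.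
have Am g g' : A g -> A g' -> A (fun s => g s * g' s).
  move=> [A0 [E H]] [A0' [E' H']]; exists (A0 * A0'), (E + E')%N => s.
  by rewrite exprD mulrACA H H' hornerM.
have Aa g g' : A g -> A g' -> A (fun s => g s + g' s).
  move=> [A0 [E H]] [A0' [E' H']]; exists (A0 * q ^+ E' + A0' * q ^+ E), (E + E')%N => s.
  rewrite hornerD !hornerM !horner_exp -H -H' exprD; ring.
have ye (s : S) l : dot e (y (val s) l) != 0.
  have [_ H _] := Hy (val s); move: (valP s); rewrite -Hq H mulf_eq0 negb_or.
  by move=> /andP [_ /prodf_neq0]; apply.
have c0 (s : S) : Y (val s) != 0.
  have [_ H _] := Hy (val s); move: (valP s); rewrite -Hq H mulf_eq0 negb_or.
  by move=> /andP [].
have [||t|A0 [E HE]] := @multisymmetric C S A Ac Aa Am T m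
   (fun s l t => (dot e (y (val s) l))^-1 * y (val s) l t) e _ _ k
   (fun t s => line a b (val s) t).
- move=> h; have [A0 _ H0] := p_poly h; exists A0, 1%N => s.
  have [_ H _] := Hy (val s).
  by rewrite (split_normalize _ (c0 s)) // -!H H0 Hq expr1 divfK //; apply: (valP s).
- by move=> s l; rewrite dotZr mulVf.
- exists ((a t)%:P + b t *: 'X), 0%N => s.
  by rewrite expr0 mulr1 hornerD hornerC hornerZ hornerX /line [b t * _]mulrC.
have fE s : q.[s] != 0 -> f s * q.[s] ^+ E = (A0 * q ^+ k).[s].
  move=> qs; rewrite hornerM -(HE (exist _ s qs)) horner_exp /=.
  have [_ H ->] := Hy s; have ye' := ye (exist _ s qs); rewrite /= in ye'.
  by rewrite (pow_normalize _ _ _ ye') -H Hq -mulrA [LHS]mulrC.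
have [q' Hq'] : exists q' : weights -> {poly C}, forall w s, p s (vec w) = (q' w).[s].
  suff /choice [q' H] : forall w, exists r : {poly C}, forall s, p s (vec w) = r.[s].
    by exists q'.
  by move=> w; have [r _ Hr] := p_poly (vec w); exists r.
have [|s qs|Q EQ] := @dominated_dvd C _ (R_of q') q (A0 * q ^+ k) (q ^+ E) q0.
- by rewrite expf_neq0.
- by rewrite -fE // normrM horner_exp mulrC ler_wpM2l // f_dominated.
exists Q => s qs; apply: (mulIf (expf_neq0 E qs)).
by rewrite fE // EQ hornerM horner_exp mulrC.
Qed.

(** The values f(s) are power transforms of forms that vary polynomially with s,
    each with a factorization of its own, chosen without any regularity in s.
    Off the zeros of s |-> p_s(e) the function f agrees with one polynomial; the
    remaining points are reached by changing [e], or, where the whole form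
    vanishes, by domination. *)
Lemma power_transform_poly : exists2 Q : {poly C},
  (size Q <= m + (D.-1 * k).+1)%N & forall s, f s = Q.[s].
Proof.
have [q' Hq'] : exists q' : weights -> {poly C}, forall w,
    (size (q' w) <= D)%N /\ forall s, p s (vec w) = (q' w).[s].
  suff /choice [q' H] : forall w, exists r : {poly C}, (size r <= D)%N /\
      forall s, p s (vec w) = r.[s] by exists q'.
  by move=> w; have [r sr Hr] := p_poly (vec w); exists r.
have Hdom := f_dominated (fun w => (Hq' w).2).
have f_zero s : (forall h, p s h = 0) -> f s = 0.
  move=> Hs; have [w] := f_bound s.
  by rewrite Hs normr0 expr0n eqn0Ngt k_gt0 mulr0 normr_le0 => /eqP.
have f_ext e q s0 : (forall s, p s e = q.[s]) -> q.[s0] != 0 ->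
    exists2 Q : {poly C}, f s0 = Q.[s0] & forall s, q.[s] != 0 -> f s = Q.[s].
  move=> Hq qs; have [|Q HQ] := f_poly_off Hq; last by exists Q; rewrite ?HQ.
  by apply: contra_neq qs => ->; rewrite horner0.
have [[e [q [Hq q0]]]|Hall] := EM (exists e q, (forall s, p s e = q.[s]) /\ q != 0).
  have [Q HQ] := f_poly_off Hq q0.
  have R0 s0 : f s0 = Q.[s0].
    have [Hs|/existsNP [e0]] := EM (forall h, p s0 h = 0).
      rewrite (f_zero _ Hs); symmetry.
      apply: (dominated_root (R := R_of q') q0) => [s qs|i].
        by rewrite -HQ.
      rewrite hornerZ hornerM hornerXn horner_exp -(Hq' i.1).2 Hs expr0n eqn0Ngt k_gt0.
      by rewrite !mulr0.
    have [q1 _ Hq1] := p_poly e0; rewrite Hq1 => /eqP qs0.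
    have [Q1 -> HQ1] := f_ext e0 q1 s0 Hq1 qs0; congr horner.
    apply/eqP; rewrite -subr_eq0; apply: contraT => d0.
    have q10 : q1 != 0 by apply: contra_neq qs0 => ->; rewrite horner0.
    have [j] := exists_nonroot (mulf_neq0 (mulf_neq0 d0 q10) q0) (@mulrIn C _ (oner_neq0 C)).
    rewrite !hornerM !mulf_eq0 !negb_or hornerD hornerN => /andP [/andP [dj q1j] qj].
    by rewrite -HQ1 // -HQ // subrr eqxx in dj.
  exists Q => //; apply: (dominated_size (R := R_of q') q0) => [s qs|[w j]].
    by rewrite -HQ.
  rewrite (leq_trans (size_scale_leq _ _)) // (leq_trans (size_polyMleq _ _)) //.
  rewrite size_polyXn addSn /= leq_add //; first by rewrite -ltnS.
  rewrite (leq_trans (size_poly_exp_leq _ _)) // ltnS leq_mul2r.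
  by have [sq _] := Hq' w; rewrite -!subn1 leq_sub2r ?orbT.
exists 0; first by rewrite size_poly0.
move=> s; rewrite horner0; apply: f_zero => h; apply/eqP; apply: contraT => Hs.
have [q _ Hq] := p_poly h; case: Hall; exists h, q; split => //.
by apply: contra_neq Hs => q0; rewrite Hq q0 horner0.
Qed.

End PowerTransform.

Section HyperplaneFactor.
Variables (C : numClosedFieldType) (T : finType).

(** The hyperplane is irreducible: a product of linear forms that vanishes on it
    has a factor that vanishes on it. *)
Lemma hyperplane_factor m (c : C) (y : T -> C) (z : 'I_m -> T -> C) :
  c != 0 -> (exists t, y t != 0) ->
  (forall h, dot h y = 0 -> c * \prod_l dot h (z l) = 0) ->
  exists l, exists b, forall t, z l t = b * y t.
Proof.
move=> c0 [t0 y0] H; apply: contrapT => Hz.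
have [l _|a Ha] := @common_nonzero_dot C T _ (index_enum 'I_m)
    (fun l t => z l t - z l t0 / y t0 * y t).
  apply: contrapT => Hl; apply: Hz; exists l, (z l t0 / y t0) => t.
  apply/eqP; rewrite -subr_eq0; apply: contraT => Ht.
  by case: Hl; exists t.
pose h := line a (fun t => (t == t0)%:R) (- (dot a y / y t0)).
have hy : dot h y = 0 by rewrite dot_line dot_unit mulNr divfK // subrr.
have /eqP := H h hy; rewrite mulf_eq0 (negbTE c0) /= => /prodf_eq0 [l _].
rewrite dot_line dot_unit => /eqP E; have := Ha l (mem_index_enum _).
by rewrite dotBr dotZr; case/eqP; rewrite -[RHS]E; field.
Qed.

End HyperplaneFactor.

(** * Systems of forms with a resultant *)

Section Systems.
Variables (C : numClosedFieldType) (n : nat) (d : 'I_n -> nat).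
Hypothesis d_gt0 : forall i, (0 < d i)%N.
Local Notation T := (coefidx d).
Implicit Types (x : 'I_n -> C) (a h : T -> C) (i j : 'I_n).

Lemma coefidxP i (m : 'X_{1..n}) : mdeg m = d i ->
  exists v : T, form_of v = i /\ mon_of v = m.
Proof.
move=> E; have lt : (mdeg m < (d i).+1)%N by rewrite E.
have eqd : mdeg (BMultinom lt) == d i by rewrite /= E.
by exists (Tagged _ (exist _ (BMultinom lt) eqd)).
Qed.

Lemma coefidx_inj (v w : T) : form_of v = form_of w -> mon_of v = mon_of w -> v = w.
Proof.
case: v w => [i v] [j w]; rewrite /form_of /= => E; subst j.
by rewrite /mon_of /= => E; congr Tagged; apply/val_inj/val_inj.
Qed.

Lemma mdeg_mon_of (v : T) : mdeg (mon_of v) = d (form_of v).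
Proof. by case: v => i [v Hv]; apply/eqP. Qed.

Definition monv x (m : 'X_{1..n}) : C := \prod_b x b ^+ m b.

(** The linear functional on coefficient vectors that evaluates the i-th form at
    [x], after its monomials have been replaced by their k-th powers. *)
Definition pt k i x : T -> C :=
  fun v => if form_of v == i then monv x (mon_of v) ^+ k else 0.

Definition mix i a h : T -> C := fun v => if form_of v == i then h v else a v.

Definition nonzero x := exists b, x b != 0.

Lemma monv_pure x b e : monv x (U_(b) *+ e)%MM = x b ^+ e.
Proof.
rewrite /monv (bigD1 b) //= mulmnE mnm1E eqxx mul1n big1 ?mulr1 // => c cb.
by rewrite mulmnE mnm1E eq_sym (negbTE cb) mul0n.
Qed.

Lemma monvM x m m' : monv x (m + m')%MM = monv x m * monv x m'.
Proof.
by rewrite /monv -big_split; apply: eq_bigr => b _ /=; rewrite mnmDE exprD.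
Qed.

Lemma monvZ (c : C) x m : monv (fun b => c * x b) m = c ^+ mdeg m * monv x m.
Proof.
rewrite /monv mdegE -prodrXr -big_split; apply: eq_bigr => b _ /=.
by rewrite exprMn.
Qed.

Lemma mdeg_pure b e : mdeg (U_(b) *+ e : 'X_{1..n})%MM = e.
Proof. by rewrite mdegMn mdeg1 mul1n. Qed.

Lemma ptZ k i (c : C) x : pt k i (fun b => c * x b) = fun v => c ^+ (d i * k) * pt k i x v.
Proof.
apply: funext => v; rewrite /pt; case: eqP => [E|_]; last by rewrite mulr0.
by rewrite monvZ mdeg_mon_of E exprMn exprM.
Qed.

Lemma pt_nonzero k i x : nonzero x -> exists v, pt k i x v != 0.
Proof.
move=> [b xb]; have [v [E Ev]] := coefidxP (mdeg_pure b (d i)).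
by exists v; rewrite /pt E eqxx Ev monv_pure !expf_neq0.
Qed.

Lemma pow_pt k i x : (0 < k)%N -> pow k (pt 1 i x) = pt k i x.
Proof.
move=> k0; apply: funext => v; rewrite /pow /pt; case: eqP => _ //.
by rewrite expr0n eqn0Ngt k0.
Qed.

(** A point of projective space is determined by its image under the Veronese
    embedding. *)
Lemma pt1_inj i x x' (c : C) : nonzero x -> nonzero x' ->
  (forall v, pt 1 i x v = c * pt 1 i x' v) ->
  exists2 e, e != 0 & x = fun b => e * x' b.
Proof.
move=> Hx Hx' E.
have Em m : mdeg m = d i -> monv x m = c * monv x' m.
  by move=> /coefidxP [v [Ev <-]]; have := E v; rewrite /pt Ev eqxx !expr1.
have [b xb] := Hx.
have Eb := Em _ (mdeg_pure b (d i)); rewrite !monv_pure in Eb.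
have x'b : x' b != 0.
  apply: contra_neq (expf_neq0 (d i) xb) => x'0.
  by rewrite Eb x'0 expr0n eqn0Ngt d_gt0 mulr0.
have c0 : c != 0.
  by apply: contra_neq (expf_neq0 (d i) xb) => c0; rewrite Eb c0 mul0r.
exists (c * x' b ^+ (d i).-1 / x b ^+ (d i).-1).
  by rewrite !mulf_neq0 ?invr_eq0 ?expf_neq0.
apply: funext => e; have := Em (U_(b) *+ (d i).-1 + U_(e) *+ 1)%MM.
rewrite mdegD !mdeg_pure addn1 prednK // => /(_ erefl).
rewrite !monvM !monv_pure !expr1 mulrA => E'.
by apply: (mulfI (expf_neq0 (d i).-1 xb)); rewrite E' !mulrA; field; rewrite expf_neq0.
Qed.

Lemma dot_mix i a h k x : dot (mix i a h) (pt k i x) = dot h (pt k i x).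
Proof.
by apply: eq_bigr => v _; rewrite /mix /pt; case: eqP => // _; rewrite !mulr0.
Qed.

Lemma dot_mix_neq i j a h k x : j != i ->
  dot (mix i a h) (pt k j x) = dot a (pt k j x).
Proof.
move=> ji; apply: eq_bigr => v _; rewrite /mix /pt; case: (form_of v =P j) => [->|_].
  by rewrite (negbTE ji).
by rewrite !mulr0.
Qed.

Lemma mix_mix i a h h' : mix i (mix i a h) h' = mix i a h'.
Proof. by apply: funext => v; rewrite /mix; case: eqP. Qed.

Lemma mix_id i a : mix i a a = a.
Proof. by apply: funext => v; rewrite /mix; case: eqP. Qed.

Lemma mixC i j a h h' : i != j -> mix i (mix j a h) h' = mix j (mix i a h') h.
Proof.
move=> ij; apply: funext => v; rewrite /mix; case: (form_of v =P i) => // ->.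
by rewrite (negbTE ij).
Qed.

Lemma line_mix i a b h h' s : line (mix i a h) (mix i b h') s = mix i (line a b s) (line h h' s).
Proof. by apply: funext => v; rewrite /line /mix; case: eqP. Qed.

(** Where [V] vanishes identically in the j-th slot, [c] is 0 and the points x_l
    are arbitrary. *)
Definition factors_at (k : 'I_n -> nat) (V : (T -> C) -> C) j a M c (x : 'I_M -> 'I_n -> C) :=
  [/\ forall l, nonzero (x l),
      forall h, V (mix j a h) = c * \prod_l dot h (pt (k j) j (x l))
    & c != 0 -> forall l i, i != j -> dot a (pt (k i) i (x l)) = 0].

(** [V] plays the role of the resultant of the forms
    sum_alpha a_(i,alpha) x^(k_i alpha). The condition that [V] vanishes only when
    there is a common zero is required in the form of a splitting, and only for
    the slots in [U], whose monomials have not been raised yet: this weaker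
    condition is preserved by [raise] without any dimension theory. *)
Record resultant_like (k m : 'I_n -> nat) (U : pred 'I_n) (V : (T -> C) -> C) : Prop :=
  ResultantLike {
  rl_poly : exists D, linepoly D V;
  rl_homog : forall i c a, V (mix i a (fun v => c * a v)) = c ^+ m i * V a;
  rl_zero : forall a x, nonzero x -> (forall i, dot a (pt (k i) i x) = 0) -> V a = 0;
  rl_exp1 : forall i, U i -> k i = 1%N;
  rl_split : forall i a, U i ->
    exists c, exists x : 'I_(m i) -> 'I_n -> C, factors_at k V i a c x
}.

Section Raise.
Variables (k m : 'I_n -> nat) (U : pred 'I_n) (V : (T -> C) -> C).
Hypothesis HV : resultant_like k m U V.
Variables (i : 'I_n) (r : nat).
Hypotheses (Ui : U i) (r_gt0 : (0 < r)%N).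

Let k' j := if j == i then r else k j.
Let m' j := if j == i then m i else (r * m j)%N.
Let U' := [pred j | U j & j != i].

Variable V' : (T -> C) -> C.
Hypothesis V'P : forall a, exists c, exists x : 'I_(m i) -> 'I_n -> C,
  factors_at k V i a c x /\
  forall h, V' (mix i a h) = c ^+ r * \prod_l dot h (pt r i (x l)).

Let ki : k i = 1%N. Proof. exact (rl_exp1 HV Ui). Qed.

Let pow_pts M (x : 'I_M -> 'I_n -> C) h :
  \prod_l dot h (pt r i (x l)) = \prod_l dot h (pow r (pt (k i) i (x l))).
Proof. by apply: eq_bigr => l _; rewrite ki pow_pt. Qed.

Let pts_nonzero M (x : 'I_M -> 'I_n -> C) : (forall l, nonzero (x l)) ->
  forall l, exists v, pt (k i) i (x l) v != 0.
Proof. by move=> Hx l; apply: pt_nonzero. Qed.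

(** Along a line the form in the i-th slot varies polynomially, so
    [power_transform_poly] applies. *)
Lemma raise_poly : exists D, linepoly D V'.
Proof.
have [D HD] := rl_poly HV; exists (m i + (D.-1 * r).+1)%N => a b.
apply: (@power_transform_poly C T r (m i) D (fun s h => V (mix i (line a b s) h))
  (fun s => V' (line a b s)) a b r_gt0) => [h|s].
  have [q sq Hq] := HD (mix i a h) (mix i b (fun=> 0)); exists q => // s.
  rewrite -Hq line_mix; congr (V (mix i _ _)).
  by apply: funext => v; rewrite /line mulr0 addr0.
have [c [x [[x0 Hx _] HV']]] := V'P (line a b s).
exists c, (fun l => pt (k i) i (x l)); split => //; first exact: pts_nonzero.
by rewrite -{1}(mix_id i (line a b s)) HV' pow_pts.
Qed.

(** In the other slots this rests on uniqueness: the factorizations chosen before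
    and after scaling are unrelated. *)
Lemma raise_homog j c a : V' (mix j a (fun v => c * a v)) = c ^+ m' j * V' a.
Proof.
have [e [x [[x0 Hx _] HV']]] := V'P a; rewrite /m'; case: eqP => [->|/eqP ji].
  have -> : V' a = e ^+ r * \prod_l dot a (pt r i (x l)) by rewrite -HV' mix_id.
  rewrite HV' (eq_bigr _ (fun l _ => dotZl _ _ _)).
  by rewrite big_split /= prodr_const card_ord mulrCA.
set a' := mix j a _; have [e' [x' [[x0' Hx' _] HV'']]] := V'P a'.
have -> : V' a = e ^+ r * \prod_l dot a (pt r i (x l)) by rewrite -HV' mix_id.
rewrite -(mix_id i a') HV'' !pow_pts.
have -> : c ^+ (r * m j) * (e ^+ r * \prod_l dot a (pow r (pt (k i) i (x l)))) =
    (c ^+ m j * e) ^+ r * \prod_l dot a (pow r (pt (k i) i (x l))).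
  by rewrite exprMn -exprM [(m j * r)%N]mulnC mulrA.
have -> : \prod_l dot a' (pow r (pt (k i) i (x' l))) =
          \prod_l dot a (pow r (pt (k i) i (x' l))).
  by rewrite -!pow_pts; apply: eq_bigr => l _; rewrite dot_mix_neq // eq_sym.
apply: power_transform_unique => // [||h]; try exact: pts_nonzero.
rewrite -Hx' -mulrA -Hx -(rl_homog HV); congr V; rewrite /a' mixC 1?eq_sym //.
apply: funext => v; rewrite /mix; case: eqP => // ->.
by rewrite (negbTE ji).
Qed.

(** A common zero [x] of the other forms must occur among the x_l, since [V]
    vanishes on the hyperplane of all h with h(x) = 0. *)
Lemma raise_zero a x : nonzero x -> (forall j, dot a (pt (k' j) j x) = 0) -> V' a = 0.
Proof.
move=> Hx Hz; have [c [z [[z0 Hz' _] HV']]] := V'P a.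
rewrite -(mix_id i a) HV'; have [->|c0] := eqVneq c 0.
  by rewrite expr0n eqn0Ngt r_gt0 mul0r.
have [h hx|l [e E]] := hyperplane_factor c0 (pt_nonzero (k i) i Hx)
    (z := fun l => pt (k i) i (z l)).
  rewrite -Hz'; apply: (rl_zero HV Hx) => j; have [->|ji] := eqVneq j i.
    by rewrite dot_mix.
  by have := Hz j; rewrite dot_mix_neq // /k' (negbTE ji).
rewrite (bigD1 l) //= (_ : dot _ _ = 0) ?mul0r ?mulr0 //.
rewrite -pow_pt // (_ : pow _ _ = fun v => e ^+ r * pt r i x v).
  by have := Hz i; rewrite /k' eqxx dotZr => ->; rewrite mulr0.
apply: funext => v; have := E v; rewrite ki -(pow_pt i x r_gt0) /pow => ->.
by rewrite exprMn.
Qed.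

(** The zero set of V' in slot j consists of the hyperplanes given by common zeros
    and of the locus where V vanishes identically in slot i. For two generic
    vectors g1, g2 in slot i, that locus lies in the zero set of both V(g1) and
    V(g2), which split over disjoint sets of points; hence it has codimension 2
    and [splitting] applies. *)
Lemma raise_split j a : U' j ->
  exists c, exists x : 'I_(m' j) -> 'I_n -> C, factors_at k' V' j a c x.
Proof.
move=> /andP [Uj ji]; pose M := m' j; rewrite -/M.
have k'j : k' j = 1%N by rewrite /k' (negbTE ji) (rl_exp1 HV).
have [[h0 /eqP Hh0]|H0] := EM (exists h, V' (mix j a h) <> 0); last first.
  exists 0, (fun _ _ => 1); split=> [l|h|]; last by rewrite eqxx.
    by exists j; rewrite oner_neq0.
  by rewrite mul0r; apply: contrapT => H; apply: H0; exists h.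
pose Y y := exists2 x, nonzero x /\ (forall l, l != j -> dot a (pt (k' l) l x) = 0) &
  y = pt (k' j) j x.
have [D HD] := raise_poly.
pose f h := V' (mix j a h).
have f_poly : linepoly D f.
  move=> h h'; have [q sq Hq] := HD (mix j a h) (mix j (fun=> 0) h').
  exists q => // s; rewrite -Hq line_mix /f; congr (V' (mix j _ _)).
  by apply: funext => v; rewrite /line mulr0 addr0.
have f_homog c h : f (fun v => c * h v) = c ^+ M * f h.
  rewrite /f -raise_homog mix_mix; congr (V' _).
  by apply: funext => v; rewrite /mix; case: eqP.
have f_van y h : Y y -> dot h y = 0 -> f h = 0.
  move=> [x [x0 Hx] ->] hx; apply: (raise_zero x0) => l.
  by have [->|lj] := eqVneq l j; rewrite ?dot_mix // dot_mix_neq // Hx.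
have [c0 [x0 [[x00 Hx0 _] HV0]]] := V'P (mix j a h0).
have c00 : c0 != 0.
  apply: contra_neq Hh0 => c00; rewrite -(mix_id i (mix j a h0)) HV0 c00.
  by rewrite expr0n eqn0Ngt r_gt0 mul0r.
have [g1 Hg1] := split_form_nonzero (pts_nonzero x00) c00; rewrite -Hx0 in Hg1.
have split_g g : V (mix i (mix j a h0) g) != 0 -> exists c, exists x : 'I_(m j) -> 'I_n -> C,
    [/\ forall l, nonzero (x l), forall h, V (mix i (mix j a h) g) = c * \prod_l dot h (pt 1 j (x l))
      & c != 0 /\ forall l, dot g (pt 1 i (x l)) = 0].
  move=> Hg; have [c [x [x1 Hx Hc]]] := rl_split HV (mix i a g) Uj.
  have Hx' h : V (mix i (mix j a h) g) = c * \prod_l dot h (pt 1 j (x l)).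
    by rewrite mixC 1?eq_sym // Hx (rl_exp1 HV Uj).
  have c1 : c != 0 by apply: contra_neq Hg => c1; rewrite Hx' c1 mul0r.
  exists c, x; split => //; split=> // l.
  by have := Hc c1 l i; rewrite eq_sym ji => /(_ isT); rewrite ki dot_mix.
have [c1 [x1 [x10 Hx1 [c10 Hg1x]]]] := split_g _ Hg1.
have [g2 [Hg2 Hg2x]] : exists g2, V (mix i (mix j a h0) g2) != 0 /\
    forall l, dot g2 (pt 1 i (x1 l)) != 0.
  pose F (o : 'I_(m i) + 'I_(m j)) : T -> C := match o with
    | inl l => pt (k i) i (x0 l) | inr l => pt 1 i (x1 l) end.
  have [o _|g Hg] := @common_nonzero_dot C T _ (index_enum _) F.
    by case: o => l; apply: pt_nonzero.
  exists g; split=> [|l]; last by apply: (Hg (inr l)); apply: mem_index_enum.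
  rewrite Hx0 mulf_neq0 //; apply/prodf_neq0 => l _.
  by apply: (Hg (inl l)); apply: mem_index_enum.
have [c2 [x2 [x20 Hx2 [c20 Hg2y]]]] := split_g _ Hg2.
have indep (p : 'I_(m j) * 'I_(m j)) c c' :
    (forall v, c * pt 1 j (x1 p.1) v + c' * pt 1 j (x2 p.2) v = 0) -> c = 0 /\ c' = 0.
  move=> E; have [v1 Hv1] := pt_nonzero 1 j (x10 p.1).
  have [v2 Hv2] := pt_nonzero 1 j (x20 p.2).
  have [c'0|c'0] := eqVneq c' 0.
    split=> //; have /eqP := E v1; rewrite c'0 mul0r addr0 mulf_eq0 (negbTE Hv1) orbF.
    by move/eqP.
  have [v|e e0 Ex] := @pt1_inj j (x2 p.2) (x1 p.1) (- c / c') (x20 _) (x10 _).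
    apply: (mulfI c'0); rewrite mulrA mulrCA mulfV // mulr1 mulNr.
    by apply/eqP; rewrite -addr_eq0 addrC E.
  have /eqP := Hg2y p.2; rewrite Ex ptZ dotZr mulf_eq0 (negbTE (Hg2x _)) orbF.
  by rewrite expf_eq0 (negbTE e0) andbF.
have f_zero h : f h = 0 -> (exists2 y, Y y & dot h y = 0) \/
    exists p : 'I_(m j) * 'I_(m j),
      dot h (pt 1 j (x1 p.1)) = 0 /\ dot h (pt 1 j (x2 p.2)) = 0.
  rewrite /f => fh; have [c [x [[x3 Hx Hc] Hh]]] := V'P (mix j a h).
  have [c3|c3] := eqVneq c 0; [right|left].
    have /eqP := Hx g1; rewrite Hx1 c3 mul0r mulf_eq0 (negbTE c10) => /prodf_eq0 [l1 _ /eqP E1].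
    have /eqP := Hx g2; rewrite Hx2 c3 mul0r mulf_eq0 (negbTE c20) => /prodf_eq0 [l2 _ /eqP E2].
    by exists (l1, l2).
  move: fh; rewrite -(mix_id i (mix j a h)) Hh => /eqP.
  rewrite mulf_eq0 expf_eq0 (negbTE c3) andbF /= => /prodf_eq0 [l _ /eqP El].
  exists (pt (k' j) j (x l)).
    exists (x l) => //; split => // e ej; have [->|ei] := eqVneq e i.
      by move: El; rewrite dot_mix_neq 1?eq_sym // /k' eqxx.
    by have := Hc c3 l e ei; rewrite dot_mix_neq // /k' (negbTE ei).
  by have := Hc c3 l j ji; rewrite dot_mix /k' (negbTE ji).
have [c [y [Yy Hf]]] := splitting f_poly f_homog Hh0 f_van indep f_zero.
suff /choice [x Hx] : forall l, exists x, (nonzero x /\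
    (forall l, l != j -> dot a (pt (k' l) l x) = 0)) /\ y l = pt (k' j) j x.
  exists c, x; split=> [l|h|_ l]; try by case: (Hx l) => -[].
  by rewrite -/(f h) Hf; congr (_ * _); apply: eq_bigr => l _; rewrite (Hx l).2.
by move=> l; have [x Hx ->] := Yy l; exists x.
Qed.

End Raise.

(** The factorization may be chosen as a function of [a] with the i-th slot
    erased, so that V' is given by one product in that slot. *)
Theorem raise k m U V i r : resultant_like k m U V -> U i -> (0 < r)%N ->
  exists2 V', resultant_like (fun j => if j == i then r else k j)
      (fun j => if j == i then m i else (r * m j)%N) [pred j | U j & j != i] V' &
    forall a, exists c, exists x : 'I_(m i) -> 'I_n -> C, factors_at k V i a c x /\
      forall h, V' (mix i a h) = c ^+ r * \prod_l dot h (pt r i (x l)).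
Proof.
move=> HV Ui r0.
have [c Hc] := choice (fun a => rl_split HV a Ui); have {Hc}[x Hx] := choice Hc.
pose o a := mix i a (fun=> 0).
pose V' a := c (o a) ^+ r * \prod_l dot a (pt r i (x (o a) l)).
have V'P a : exists c, exists x : 'I_(m i) -> 'I_n -> C, factors_at k V i a c x /\
      forall h, V' (mix i a h) = c ^+ r * \prod_l dot h (pt r i (x l)).
  exists (c (o a)), (x (o a)); have [H1 H2 H3] := Hx (o a); split.
    split => // [h|c0 l j ji]; first by rewrite -H2 mix_mix.
    by have := H3 c0 l j ji; rewrite dot_mix_neq.
  move=> h; rewrite /V' {1 2}/o !mix_mix; congr (_ * _).
  by apply: eq_bigr => l _; rewrite dot_mix.
exists V' => //; split.
- exact: raise_poly HV _ _ Ui r0 _ V'P.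
- exact: raise_homog HV _ _ Ui r0 _ V'P.
- exact: raise_zero HV _ _ Ui r0 _ V'P.
- by move=> j /andP [Uj /negbTE ->]; apply: rl_exp1 HV _ Uj.
- move=> j a; exact: raise_split HV _ _ Ui r0 _ V'P _ _.
Qed.

End Systems.

(** * Replacing all forms by diagonal forms *)

Lemma det_norm_le (C : numClosedFieldType) n (A : 'M[C]_n) (M : C) :
  (forall i j, `|A i j| <= M) -> `|\det A| <= n`!%:R * M ^+ n.
Proof.
move=> HA; apply: le_trans (ler_norm_sum _ _ _) _.
have -> : n`!%:R * M ^+ n = \sum_(s : 'S_n) M ^+ n.
  by rewrite sumr_const card_Sn mulr_natl.
apply: ler_sum => s _; rewrite normrM normrX normrN1 expr1n mul1r normr_prod.
have -> : M ^+ n = \prod_(i < n) M by rewrite prodr_const card_ord.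
by apply: ler_prod => i _; rewrite normr_ge0 HA.
Qed.

(** Applying the adjugate of [A] shows that det A times [z] is z_i times the vector
    of cofactors of the i-th row. *)
Lemma cramer_row (F : comNzRingType) n (A : 'M[F]_n) i (t z : 'I_n -> F) :
  (forall j, j != i -> \sum_b A j b * z b = 0) -> (forall b, A i b = (i == b)%:R) ->
  \det A * \sum_b t b * z b = z i * \sum_b t b * cofactor A i b.
Proof.
move=> HA Ai; pose v : 'cV[F]_n := \col_b z b.
have Av : A *m v = \col_j ((j == i)%:R * z i).
  apply/colP => j; rewrite !mxE.
  have [->|ji] := eqVneq j i.
    rewrite (bigD1 i) //= Ai eqxx mxE big1 ?addr0 // => b bi.
    by rewrite Ai eq_sym (negbTE bi) mul0r.
  by rewrite mul0r -[RHS](HA j ji); apply: eq_bigr => b _; rewrite mxE.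
have E b : \det A * z b = cofactor A i b * z i.
  have := congr1 (fun w : 'cV[F]_n => w b 0) (congr1 (mulmx (\adj A)) Av).
  rewrite mulmxA mul_adj_mx mul_scalar_mx !mxE => ->.
  rewrite (bigD1 i) //= !mxE eqxx mul1r big1 ?addr0 // => j ji.
  by rewrite !mxE (negbTE ji) mul0r mulr0.
rewrite !mulr_sumr; apply: eq_bigr => b _.
by rewrite mulrCA E; ring.
Qed.

Section Chain.
Variables (C : numClosedFieldType) (n : nat) (d : 'I_n -> nat).
Hypothesis d_gt0 : forall i, (0 < d i)%N.
Local Notation T := (coefidx d).

Definition count_monomials (i : 'I_n) := #|[pred v : T | form_of v == i]|.

(** The bracket selects the monomial x_b^(d_i): the form is sum_b w_ib x_b^(d_i). *)
Definition diagonal_form (w : 'I_n -> 'I_n -> nat) : T -> C := fun v =>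
  \sum_b (mon_of v == U_(b) *+ d (form_of v))%MM%:R * (w (form_of v) b)%:R.

Lemma dot_diagonal w k i x :
  dot (diagonal_form w) (pt k i x) = \sum_b (w i b)%:R * x b ^+ (d i * k).
Proof.
rewrite /dot; under eq_bigr => v _ do rewrite mulr_suml.
rewrite exchange_big /=; apply: eq_bigr => b _.
have [v [Ev Em]] := coefidxP (mdeg_pure b (d i)).
rewrite (bigD1 v) //= Em Ev eqxx mul1r /pt Ev eqxx Em monv_pure exprM big1 ?addr0 //.
move=> u uv; case: eqP => [Eu|]; last by rewrite !mul0r.
case: eqP => [Ei|]; last by rewrite mulr0.
by case/eqP: uv; apply: coefidx_inj; rewrite ?Ei ?Ev // Eu Ei.
Qed.

(** Each monomial x^alpha satisfies |x^alpha|^(d_i k) <= Q^(d_i), being a product of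
    powers of the bounded quantities |x_b|^(d_i k); extracting roots and summing
    over the monomials gives the estimate. *)
Lemma diagonal_dominates i k x (Q : C) : (0 < k)%N ->
  (forall b, `|x b ^+ (d i * k)| <= Q) -> forall a : T -> C, (forall v, `|a v| <= 1) ->
  `|dot a (pt 1 i x)| ^+ k <= (count_monomials i)%:R ^+ k * Q.
Proof.
move=> k0 HQ a Ha.
have Q0 : 0 <= Q := le_trans (normr_ge0 _) (HQ i).
have mon (v : T) : form_of v = i -> `|monv x (mon_of v)| ^+ k <= Q.
  move=> Ev; rewrite -(ler_pXn2r (d_gt0 i)) ?nnegrE ?exprn_ge0 // -exprM mulnC.
  rewrite /monv normr_prod -prodrXl -{2}Ev -mdeg_mon_of mdegE -prodrXr.
  apply: ler_prod => b _; rewrite exprn_ge0 //= normrX -exprM mulnC exprM.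
  by rewrite -normrX lerXn2r ?nnegrE.
pose q := k.-root Q.
have q0 : 0 <= q by rewrite rootC_ge0.
have bound v : `|a v * pt 1 i x v| <= (form_of v == i)%:R * q.
  rewrite /pt; case: eqP => [Ev|_]; last by rewrite mulr0 mul0r normr0.
  rewrite mul1r expr1 normrM; apply: le_trans (ler_piMl (normr_ge0 _) (Ha v)) _.
  by rewrite -(ler_pXn2r k0) ?nnegrE // rootCK // mon.
have : `|dot a (pt 1 i x)| <= (count_monomials i)%:R * q.
  apply: le_trans (ler_norm_sum _ _ _) _; apply: le_trans (ler_sum _ (fun v _ => bound v)) _.
  rewrite -mulr_suml -natr_sum /count_monomials -sum1_card [in leRHS]big_mkcond /=.
  exact: ler_wpM2r.
by rewrite -(ler_pXn2r k0) ?nnegrE ?mulr_ge0 ?ler0n // exprMn rootCK.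
Qed.


(** Replacing the forms of index less than [r] by x_i^(d_i). The value of the
    current function at these forms is tracked together with its value at [a]: it
    stays a power of a determinant, and becomes the final value for r = 0. *)
Definition truncate (r : nat) (w : 'I_n -> 'I_n -> nat) : 'I_n -> 'I_n -> nat :=
  fun i b => if (i < r)%N then (i == b : nat) else w i b.

Definition weight_matrix (w : 'I_n -> 'I_n -> nat) : 'M[C]_n := \matrix_(i, b) (w i b)%:R.

Definition tail_forms (r : nat) (a : T -> C) (w : 'I_n -> 'I_n -> nat) : T -> C :=
  fun v => if (form_of v < r)%N then a v else diagonal_form w v.

Variables (R0 : (T -> C) -> C) (rho : nat) (a : T -> C).
Hypothesis R0P : resultant_like (fun=> 1%N) (delta d) predT R0.
Hypothesis R0_diag : R0 (diagonal_form (fun i b => (i == b : nat))) = 1.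
Hypothesis rho_gt0 : (0 < rho)%N.
Hypothesis a_le1 : forall v, `|a v| <= 1.

Let kappa i := (rho * delta d i)%N.
Let K r := (\prod_(i < n | r <= i) kappa i)%N.
Let M := (K 0).+1.
Let G : C := (2 * M)%:R ^+ n.
Let B r : C := \prod_(i < n | (r <= i)%N) (count_monomials i)%:R ^+ delta d i.

Let delta_gt0 i : (0 < delta d i)%N.
Proof. by apply: prodn_cond_gt0 => j _; apply: d_gt0. Qed.

Let kappa_gt0 i : (0 < kappa i)%N. Proof. by rewrite muln_gt0 rho_gt0 delta_gt0. Qed.

Let K_le r : (K r <= K 0)%N.
Proof.
rewrite /K [X in (_ <= X)%N](bigID (fun i : 'I_n => (r <= i)%N)) /=.
by rewrite leq_pmulr // prodn_cond_gt0 // => j _; apply: kappa_gt0.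
Qed.

Let K_step (i : 'I_n) : K i = (kappa i * K i.+1)%N.
Proof.
rewrite /K (bigD1 i) //=; congr (_ * _)%N; apply: eq_bigl => j.
by rewrite ltn_neqAle andbC; congr (_ && _); rewrite eq_sym.
Qed.

Let B_step (i : 'I_n) : B i = (count_monomials i)%:R ^+ delta d i * B i.+1.
Proof.
rewrite /B (bigD1 i) //=; congr (_ * _); apply: eq_bigl => j.
by rewrite ltn_neqAle andbC; congr (_ && _); rewrite eq_sym.
Qed.

Let kappa_d i j : (d i * kappa i = d j * kappa j)%N.
Proof.
suff E l : (d l * kappa l = rho * \prod_i d i)%N by rewrite !E.
by rewrite mulnCA (bigD1 l).
Qed.

(* The forms of index at least r have been replaced by diagonal forms of degree
   d_i kappa_i. Both estimates are raised to the power rho because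
   rho * m i = K i, which keeps all exponents integral. *)
Let invariant r := exists k m V w,
  [/\ resultant_like k m [pred i : 'I_n | (i < r)%N] V,
      (forall i : 'I_n, k i = if (i < r)%N then 1%N else kappa i) /\
      (forall i : 'I_n, (i < r)%N -> m i = (delta d i * K r)%N),
      forall i b, (w i b <= M)%N,
      `|R0 a| ^+ (rho * K r) <= B r ^+ (rho * K r) * G ^+ ((n - r) * K r) *
        `|V (tail_forms r a w)| ^+ rho
    & V (diagonal_form (truncate r w)) ^+ rho =
        \det (weight_matrix (truncate r w)) ^+ K r /\
      \det (weight_matrix (truncate r w)) != 0].

Let invariant_start : invariant n.
Proof.
have K1 : K n = 1%N by rewrite /K big1 // => i; rewrite leqNgt ltn_ord.
have B1 : B n = 1 by rewrite /B big1 // => i; rewrite leqNgt ltn_ord.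
have tE w : truncate n w = fun i b => (i == b : nat).
  by apply: funext => i; apply: funext => b; rewrite /truncate ltn_ord.
have W1 w : weight_matrix (truncate n w) = 1%:M.
  by apply/matrixP => i b; rewrite tE !mxE.
exists (fun=> 1%N), (delta d), R0, (fun _ _ => 0%N); split.
- case: R0P => H1 H2 H3 H4 H5; split; [exact: H1|exact: H2|exact: H3|by []|by move=> i a' _; apply: H5].
- by split=> i; rewrite ?ltn_ord // K1 muln1.
- by [].
- rewrite K1 B1 subnn mul0n expr0 expr1n !mul1r muln1.
  rewrite (_ : tail_forms n a _ = a) //.
  by apply: funext => v; rewrite /tail_forms ltn_ord.
- by rewrite W1 det1 K1 expr1 tE R0_diag expr1n oner_neq0.
Qed.

Let invariant_step (i : 'I_n) : invariant i.+1 -> invariant i.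
Proof.
move=> [k [m [V [w [HV [Hk Hm] Hw HC [HA HD]]]]]].
have Ui : (i < i.+1)%N by [].
have [V' HV' V'P] := raise d_gt0 HV Ui (kappa_gt0 i).
have mi : m i = (delta d i * K i.+1)%N by apply: Hm.
have Kmi : (rho * m i = K i)%N by rewrite mi K_step /kappa mulnA.
have ki : k i = 1%N by rewrite Hk Ui.
have [c [x [[x0 Hx _] HV1]]] := V'P (tail_forms i.+1 a w).
have [c' [x' [[x0' Hx' Hc'] HV1']]] := V'P (diagonal_form (truncate i.+1 w)).
pose W1 := weight_matrix (truncate i.+1 w); rewrite -/W1 in HA HD.
have M0 : (0 < M)%N by [].
(* the cofactors are included among the linear forms to keep the new determinant
   nonzero *)
pose y (o : option 'I_(m i)) (b : 'I_n) : C :=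
  if o is Some l then x l b ^+ (d i * kappa i) else cofactor W1 i b.
have [|t Ht] := @good_weights C 'I_n (option 'I_(m i)) M y M0.
  rewrite card_option card_ord ltnS; apply: leq_trans (K_le i).
  by rewrite -Kmi leq_pmull.
rewrite card_ord -/G in Ht.
pose w' j b := if j == i then (t b : nat) else w j b.
have tailE : tail_forms i a w' = mix i (tail_forms i.+1 a w) (diagonal_form w').
  apply: funext => v; rewrite /tail_forms /mix /diagonal_form /w'.
  have [->|vi] := eqVneq (form_of v) i; first by rewrite ltnn.
  by rewrite ltnS [in RHS]leq_eqVlt (negbTE (vi : form_of v != i :> nat)).
have diagE : diagonal_form (truncate i w') =
    mix i (diagonal_form (truncate i.+1 w)) (diagonal_form w').
  apply: funext => v; rewrite /mix /diagonal_form /truncate /w'.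
  have [->|vi] := eqVneq (form_of v) i; first by rewrite ltnn.
  by rewrite ltnS [in RHS]leq_eqVlt (negbTE (vi : form_of v != i :> nat)).
have dot_w' z : dot (diagonal_form w') (pt (kappa i) i z) =
    \sum_b (t b)%:R * z b ^+ (d i * kappa i).
  by rewrite dot_diagonal; apply: eq_bigr => b _; rewrite /w' eqxx.
have HVC : `|V (tail_forms i.+1 a w)| ^+ kappa i <=
    (count_monomials i)%:R ^+ (kappa i * m i) * G ^+ m i * `|V' (tail_forms i a w')|.
  rewrite tailE HV1 -{1}(mix_id i (tail_forms i.+1 a w)) Hx ki.
  rewrite !normrM !normr_prod exprMn normrX mulrCA ler_wpM2l ?exprn_ge0 //.
  have -> : (count_monomials i)%:R ^+ (kappa i * m i) * G ^+ m i =
      \prod_(l < m i) ((count_monomials i)%:R ^+ kappa i * G) :> C.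
    by rewrite prodr_const card_ord exprMn exprM.
  rewrite -prodrXl -big_split /=; apply: ler_prod => l _.
  rewrite exprn_ge0 //= dot_w' -mulrA.
  have -> : dot (tail_forms i.+1 a w) (pt 1 i (x l)) = dot a (pt 1 i (x l)).
    apply: eq_bigr => v _; rewrite /tail_forms /pt.
    by case: (form_of v =P i) => [->|_]; rewrite ?ltnSn // !mulr0.
  by apply: diagonal_dominates => // b; apply: Ht (Some l) b.
pose W2 := weight_matrix (truncate i w').
have cofE b : cofactor W2 i b = cofactor W1 i b.
  congr (_ * \det _); apply/matrixP => p q; rewrite !mxE /truncate /w'.
  have pi : lift i p != i by rewrite eq_sym neq_lift.
  by rewrite (negbTE pi) ltnS [in RHS]leq_eqVlt (negbTE (pi : lift i p != i :> nat)).
have W1i b : W1 i b = (i == b)%:R by rewrite !mxE /truncate Ui.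
have detW2 : \det W2 = \sum_b (t b)%:R * cofactor W1 i b.
  rewrite (expand_det_row _ i); apply: eq_bigr => b _; rewrite cofE.
  by rewrite !mxE /truncate ltnn /w' eqxx.
have detW1 : \det W1 = cofactor W1 i i.
  rewrite (expand_det_row _ i) (bigD1 i) //= W1i eqxx mul1r big1 ?addr0 // => b bi.
  by rewrite W1i eq_sym (negbTE bi) mul0r.
have detW2_neq0 : \det W2 != 0.
  apply: contra_neq HD => W20; apply/eqP; rewrite detW1 -normr_le0.
  by apply: le_trans (Ht None i) _; rewrite -detW2 W20 normr0 mulr0.
have VW0 : V (diagonal_form (truncate i.+1 w)) != 0.
  apply: contraTneq isT => V0; move: HA; rewrite V0 expr0n eqn0Ngt rho_gt0.
  by move/esym/eqP; rewrite expf_eq0 (negbTE HD) andbF.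
have c'0 : c' != 0.
  apply: contra_neq VW0 => c'0.
  by rewrite -(mix_id i (diagonal_form _)) Hx' c'0 mul0r.
(* the points x' are zeros of the forms other than the i-th, so their powers are
   annihilated by all rows but one *)
have HVD : V' (diagonal_form (truncate i w')) * \det W1 ^+ m i =
    V (diagonal_form (truncate i.+1 w)) ^+ kappa i * \det W2 ^+ m i.
  rewrite diagE HV1' -[in RHS](mix_id i (diagonal_form (truncate i.+1 w))) Hx' ki.
  rewrite exprMn -!mulrA; congr (_ * _).
  have detE D : \det D ^+ m i = \prod_(l < m i) \det D :> C.
    by rewrite prodr_const card_ord.
  rewrite !detE -prodrXl -!big_split /=; apply: eq_bigr => l _.
  rewrite dot_w' mulrC (cramer_row _ (z := fun b => x' l b ^+ (d i * kappa i)) _ W1i).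
    rewrite -detW2 dot_diagonal (bigD1 i) //= /truncate Ui eqxx mul1r muln1 exprM.
    rewrite big1 ?addr0 // => b bi; by rewrite eq_sym (negbTE bi) mul0r.
  move=> j ji; have := Hc' c'0 l j ji; rewrite dot_diagonal Hk.
  have [lt_ji|ge_ji] := ltnP j i.+1; last first.
    move=> E; rewrite -[RHS]E; apply: eq_bigr => b _.
    by rewrite (kappa_d i j) !mxE.
  have tj b : truncate i.+1 w j b = (j == b) by rewrite /truncate lt_ji.
  rewrite (bigD1 j) //= tj eqxx mul1r muln1 big1 ?addr0; last first.
    by move=> b bj; rewrite tj eq_sym (negbTE bj) mul0r.
  move=> /eqP; rewrite expf_eq0 => /andP [_ /eqP x'j].
  rewrite (bigD1 j) //= x'j expr0n muln_eq0 !eqn0Ngt d_gt0 kappa_gt0 mulr0 add0r.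
  by rewrite big1 // => b bj; rewrite !mxE tj eq_sym (negbTE bj) mul0r.
exists (fun j => if j == i then kappa i else k j),
  (fun j => if j == i then m i else (kappa i * m j)%N), V', w'; split.
- have low (j : 'I_n) : (j < i)%N -> (j < i.+1)%N && (j != i).
    by move=> ji; rewrite ltnS ltnW // -val_eqE neq_ltn ji.
  case: HV' => H1 H2 H3 H4 H5; split; [exact: H1|exact: H2|exact: H3| |].
    by move=> j ji; apply: H4; apply: low.
  by move=> j a' ji; apply: H5; apply: low.
- split=> j; have [->|ji] := eqVneq j i; rewrite ?ltnn //.
    by rewrite Hk ltnS [in LHS]leq_eqVlt (negbTE (ji : j != i :> nat)).
  by move=> lt_ji; rewrite (Hm j (leqW lt_ji)) K_step mulnCA.
- by move=> j b; rewrite /w'; case: eqP => // _; rewrite -ltnS.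
- have B0 r : 0 <= B r by apply: prodr_ge0 => j _; rewrite exprn_ge0 // ler0n.
  have G0 : 0 <= G by rewrite exprn_ge0 // ler0n.
  rewrite {1}K_step mulnCA mulnC exprM.
  apply: le_trans (lerXn2r (kappa i) _ _ HC) _.
  + by rewrite nnegrE exprn_ge0.
  + by rewrite nnegrE !mulr_ge0 // exprn_ge0 // mulr_ge0.
  have EV (z : C) : (z ^+ rho) ^+ kappa i = (z ^+ kappa i) ^+ rho.
    by rewrite -!exprM mulnC.
  rewrite exprMn EV.
  apply: le_trans (ler_wpM2l _ (lerXn2r rho _ _ HVC)) _.
  + by rewrite exprn_ge0 // mulr_ge0 // exprn_ge0.
  + by rewrite nnegrE exprn_ge0.
  + by rewrite nnegrE !mulr_ge0 // exprn_ge0 // ler0n.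
  rewrite !exprMn -!exprM B_step exprMn -exprM.
  rewrite [(m i * rho)%N]mulnC Kmi.
  have -> : (kappa i * m i * rho = delta d i * (rho * K i))%N.
    by rewrite -mulnA [(m i * rho)%N]mulnC Kmi /kappa mulnAC mulnA mulnC mulnA.
  have -> : (rho * K i.+1 * kappa i = rho * K i)%N by rewrite K_step mulnA mulnAC.
  have -> : ((n - i.+1) * K i.+1 * kappa i = (n - i.+1) * K i)%N.
    by rewrite K_step mulnA mulnAC.
  have -> : ((n - i) * K i = (n - i.+1) * K i + K i)%N.
    by rewrite -(subnSK (ltn_ord i)) mulSn addnC.
  by rewrite mulnDr exprD le_eqVlt; apply/orP; left; apply/eqP; ring.
- split => //; apply: (mulIf (expf_neq0 (rho * m i) HD)).
  rewrite [in LHS]mulnC exprM -exprMn HVD exprMn -!exprM.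
  rewrite [(kappa i * rho)%N]mulnC exprM HA -exprM [(m i * rho)%N]mulnC Kmi.
  by rewrite [(K i.+1 * _)%N]mulnC -K_step mulrC.
Qed.

Lemma resultant_power_bound :
  `|R0 a| ^+ rho <= (\prod_i (count_monomials i)%:R ^+ delta d i) ^+ rho *
    ((2 * M)%:R ^+ (n * n) * (n`!%:R * M%:R ^+ n)).
Proof.
have [k [m [V [w [_ _ Hw HC [HA HD]]]]]] : invariant 0.
  suff H j : (j <= n)%N -> invariant (n - j) by rewrite -(subnn n); apply: H.
  elim: j => [|j IH] jn; first by rewrite subn0; apply: invariant_start.
  have lt : (n - j.+1 < n)%N by rewrite ltn_subrL (leq_trans _ jn).
  apply: (@invariant_step (Ordinal lt)); rewrite /= subnSK //.
  by apply: IH; apply: ltnW.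
have K0 : (0 < K 0)%N by apply: prodn_cond_gt0 => j _; apply: kappa_gt0.
have tailE : tail_forms 0 a w = diagonal_form (truncate 0 w) by [].
have HA' : `|V (diagonal_form (truncate 0 w))| ^+ rho =
    `|\det (weight_matrix (truncate 0 w))| ^+ K 0 by rewrite -normrX HA normrX.
rewrite tailE HA' subn0 in HC.
have B0 : 0 <= B 0 by apply: prodr_ge0 => j _; rewrite exprn_ge0 // ler0n.
have G0 : 0 <= G by rewrite exprn_ge0 // ler0n.
move: HC; rewrite !exprM -!exprMn ler_pXn2r ?nnegrE ?mulr_ge0 ?exprn_ge0 // => HC.
have det_le : `|\det (weight_matrix (truncate 0 w))| <= n`!%:R * M%:R ^+ n.
  by apply: det_norm_le => i b; rewrite mxE normr_nat ler_nat; apply: Hw.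
apply: le_trans HC _; rewrite -!mulrA; apply: ler_wpM2l; first exact: exprn_ge0.
by apply: ler_wpM2l => //; apply: exprn_ge0.
Qed.

End Chain.

(** * Coefficients and values *)

Section CoefficientBound.
Variable C : numClosedFieldType.

Lemma prim_root_exists Q : (0 < Q)%N -> exists w : C, Q.-primitive_root w.
Proof.
move=> Q0; have [r Dp] := closed_field_poly_normal ('X^Q - 1 : {poly C}).
rewrite (monicP _) ?monicXnsubC // scale1r in Dp.
have rn1 : all Q.-unity_root r by apply/allP=> z; rewrite -root_prod_XsubC -Dp.
have sz_r : (Q < (size r).+1)%N by rewrite -(size_prod_XsubC r id) -Dp size_XnsubC.
have [|w] := hasP (has_prim_root Q0 rn1 _ sz_r); last by exists w.
by rewrite -separable_prod_XsubC -Dp separable_Xn_sub_1 // pnatr_eq0 -lt0n.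
Qed.

(** Cauchy's estimate, by averaging over the Q-th roots of unity. *)
Lemma coef_bound N (P : {mpoly C[N]}) (B : C) :
  (forall a, (forall k, `|a k| = 1) -> `|P.@[a]| <= B) ->
  forall m, `|P@_m| <= B.
Proof.
move=> HB m; pose Q := (msize P + mdeg m).+1.
have [w wQ] := prim_root_exists (ltn0Sn (msize P + mdeg m)); rewrite -/Q in wQ.
have wn : `|w| = 1.
  by apply/eqP; rewrite -(@pexpr_eq1 _ _ Q) // -normrX prim_expr_order // normr1.
have w0 : w != 0 by rewrite -normr_eq0 wn oner_neq0.
have mQ k : (m k < Q)%N.
  by rewrite ltnS (leq_trans _ (leq_addl _ _)) // mdegE (bigD1 k) //= leq_addr.
have avg (p q : nat) : (p < Q)%N -> (q < Q)%N ->
    \sum_(j < Q) w ^+ (j * p) * (w ^+ (j * q))^-1 = (p == q)%:R * Q%:R.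
  move=> pQ qQ; pose u := w ^+ p / w ^+ q.
  rewrite (eq_bigr (fun j : 'I_Q => u ^+ j)); last first.
    by move=> j _; rewrite /u exprMn exprVn -!exprM ![(j * _)%N]mulnC.
  have [epq|npq] := eqVneq p q.
    rewrite /u epq divff ?expf_neq0 // mul1r (eq_bigr (fun=> 1)) => [|j _].
      by rewrite sumr_const card_ord.
    by rewrite expr1n.
  have u1 : u - 1 != 0.
    rewrite subr_eq0; apply: contra npq => /eqP E.
    have : w ^+ p == w ^+ q by rewrite -[w ^+ p](divfK (expf_neq0 q w0)) -/u E mul1r.
    by rewrite (eq_prim_root_expr wQ) !modn_small.
  have uQ : u ^+ Q = 1.
    rewrite /u exprMn exprVn exprAC [(w ^+ q) ^+ Q]exprAC !(prim_expr_order wQ).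
    by rewrite !expr1n divr1.
  by apply: (mulfI u1); rewrite -subrX1 mul0r mulr0 uQ subrr.
pose a (e : {ffun 'I_N -> 'I_Q}) (k : 'I_N) : C := w ^+ e k.
have an e k : `|a e k| = 1 by rewrite normrX wn expr1n.
have E : \sum_e P.@[a e] * \prod_k (w ^+ (e k * m k))^-1 = P@_m * (Q%:R ^+ N).
  transitivity (\sum_(m' <- msupp P) P@_m' * \prod_k ((m' k == m k)%:R * Q%:R : C)).
    transitivity (\sum_(e : {ffun 'I_N -> 'I_Q}) \sum_(m' <- msupp P) P@_m' *
        \prod_k (w ^+ (e k * m' k) * (w ^+ (e k * m k))^-1)).
      apply: eq_bigr => e _; rewrite mevalE mulr_suml; apply: eq_bigr => m' _.
      rewrite big_split /= mulrA; congr (_ * _ * _).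
      by apply: eq_bigr => k _; rewrite -exprM.
    rewrite exchange_big /= !big_seq; apply: eq_bigr => m' m'P.
    rewrite -mulr_sumr; congr (_ * _).
    rewrite -(bigA_distr_bigA (fun k j => w ^+ (val j * m' k) * (w ^+ (val j * m k))^-1)) /=.
    apply: eq_bigr => k _; rewrite avg // ltnS (leq_trans _ (leq_addr _ _)) //.
    apply: leq_trans (ltnW (msize_mdeg_lt m'P)).
    by rewrite mdegE (bigD1 k) //= leq_addr.
  have prod1 (m' : 'X_{1..N}) : \prod_(k < N) ((m' k == m k)%:R * Q%:R : C) = (m' == m)%:R * Q%:R ^+ N.
    rewrite big_split /= prodr_const card_ord; congr (_ * _).
    have [->|ne] := eqVneq m' m; first by rewrite big1 // => k _; rewrite eqxx.
    apply/eqP; have [k kE] : exists k, m' k != m k.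
      apply: contrapT => H; case/eqP: ne; apply/mnmP => k; apply/eqP.
      by apply: contraT => kE; case: H; exists k.
    by rewrite (bigD1 k) //= (negbTE kE) mul0r.
  rewrite (eq_bigr _ (fun m' _ => congr1 _ (prod1 m'))).
  have [mP|mP] := boolP (m \in msupp P).
    rewrite (bigD1_seq m) ?msupp_uniq //= eqxx mul1r big1 ?addr0 // => m' /negbTE ->.
    by rewrite mul0r mulr0.
  rewrite (memN_msupp_eq0 mP) mul0r big_seq big1 // => m' m'P.
  by case: eqP m'P mP => [->|_ _ _]; [move=> ->|rewrite mul0r mulr0].
have Q0 : 0 < (Q%:R : C) ^+ N by rewrite exprn_gt0 // ltr0n.
rewrite -(ler_pM2r Q0) -{1}(gtr0_norm Q0) -normrM -E.
apply: le_trans (ler_norm_sum _ _ _) _.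
have -> : B * Q%:R ^+ N = \sum_(e : {ffun 'I_N -> 'I_Q}) B.
  by rewrite sumr_const card_ffun !card_ord -natrX mulr_natr.
apply: ler_sum => e _; rewrite normrM normr_prod (eq_bigr (fun=> 1)) => [|k _].
  by rewrite big1 // mulr1; apply: HB.
by rewrite normrV ?unitfE ?expf_neq0 // normrX wn expr1n invr1.
Qed.

End CoefficientBound.

(** The monomials of degree d_i correspond to nondecreasing d_i-tuples of
    variables. *)
Lemma count_monomialsE n (d : 'I_n -> nat) i :
  count_monomials d i = 'C(d i + n - 1, n - 1).
Proof.
case: n d i => [|n] d i; first by case: i.
rewrite addnS !subSS !subn0 -bin_sub ?leq_addl // addnK -size_basis.
rewrite /count_monomials cardE -(size_map (@mon_of _ _)); apply/perm_size/uniq_perm.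
- rewrite map_inj_in_uniq ?enum_uniq // => v w; rewrite !mem_enum !inE.
  by move=> /eqP vi /eqP wi; apply: coefidx_inj; rewrite vi wi.
- exact: uniq_basis.
move=> m; rewrite -basis_cover; apply/mapP/eqP => [[v]|Em].
  by rewrite mem_enum inE => /eqP <- ->; apply: mdeg_mon_of.
by have [v [vi <-]] := coefidxP Em; exists v; rewrite // mem_enum inE vi.
Qed.

(** * The given resultant *)

Section Resultant.
Variables (R : realType) (n : nat) (d : 'I_n -> nat).
Hypothesis d_gt0 : forall i, (0 < d i)%N.
Variables (Res : coefpoly R d) (ResP : is_resultant Res).
Local Notation C := (R[i]).
Local Notation T := (coefidx d).

Definition resultant_value (a : T -> C) : C := Res.@[fun k => a (enum_val k)].

Definition form_with (a : T -> C) (i : 'I_n) : {mpoly C[n]} :=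
  \sum_(v : T | form_of v == i) a v *: 'X_[mon_of v].

Lemma form_with_homog a i : form_with a i \is (d i).-homog.
Proof.
apply: rpred_sum => v /eqP vi; apply: rpredZ.
by rewrite dhomogX -vi; apply/eqP; apply: mdeg_mon_of.
Qed.

Lemma form_with_coef a v : (form_with a (form_of v))@_(mon_of v) = a v.
Proof.
rewrite raddf_sum (bigD1 v) //= mcoeffZ mcoeffX eqxx mulr1 big1 ?addr0 //.
move=> w /andP [/eqP wv ne]; rewrite mcoeffZ mcoeffX.
case: eqP => [E|]; last by rewrite mulr0.
by case/eqP: ne; apply: coefidx_inj.
Qed.

Lemma form_with_eval a i x : (form_with a i).@[x] = dot a (pt 1 i x).
Proof.
rewrite raddf_sum /dot [RHS](bigID (fun v : T => form_of v == i)) /=.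
rewrite [X in _ = _ + X]big1 ?addr0 => [|v vi]; last by rewrite /pt (negbTE vi) mulr0.
by apply: eq_bigr => v vi; rewrite mevalZ mevalX /pt vi expr1.
Qed.

Lemma resultant_valueE a : eval_at_forms Res (form_with a) = resultant_value a.
Proof. by apply: meval_eq => k; apply: form_with_coef. Qed.

Lemma resultant_value0 a : resultant_value a = 0 <->
  exists2 x, nonzero x & forall i, dot a (pt 1 i x) = 0.
Proof.
rewrite -resultant_valueE (resultant_vanish ResP (form_with_homog a)).
by split=> -[x x0 Hx]; exists x => // i; [rewrite -form_with_eval|rewrite form_with_eval].
Qed.

Lemma resultant_value_poly : exists D, linepoly D resultant_value.
Proof.
have HM (m : 'X_{1..#|T|}) : exists D, linepoly D (fun a : T -> C => \prod_k a (enum_val k) ^+ m k).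
  apply: linepoly_prod => k; elim: (m k) => [|j [D HD]].
    exists 1%N; rewrite (_ : (fun _ => _) = fun=> 1); first exact: linepoly_cst.
    by apply: funext => a; rewrite expr0.
  exists (2 + D)%N; rewrite (_ : (fun _ => _) = fun a : T -> C =>
    dot a (fun v => (v == enum_val k)%:R) * a (enum_val k) ^+ j).
    exact: linepolyM (linepoly_dot _) HD.
  by apply: funext => a; rewrite dot_coord exprS.
rewrite (_ : resultant_value = fun a => \sum_(m <- msupp Res)
    Res@_m * \prod_k a (enum_val k) ^+ m k) //.
elim: (msupp Res) => [|m s [D HD]].
  exists 1%N; rewrite (_ : (fun _ => _) = fun=> 0); first exact: linepoly_cst.
  by apply: funext => a; rewrite big_nil.
have [E HE] := HM m; exists (maxn D (1 + E))%N.
rewrite (_ : (fun _ => _) = fun a : T -> C =>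
  \sum_(m <- s) Res@_m * \prod_k a (enum_val k) ^+ m k -
  - Res@_m * \prod_k a (enum_val k) ^+ m k).
  exact: linepolyB HD (linepolyM (linepoly_cst _) HE).
by apply: funext => a; rewrite big_cons mulNr opprK addrC.
Qed.

Lemma resultant_value_homog i c a :
  resultant_value (mix i a (fun v => c * a v)) = c ^+ delta d i * resultant_value a.
Proof.
rewrite /resultant_value !mevalE mulr_sumr !big_seq; apply: eq_bigr => m mR.
rewrite mulrCA; congr (_ * _); rewrite -(resultant_homog ResP i mR) /partial_mdeg.
rewrite -prodrXr (reindex (@enum_val T predT)) /=; last exact/onW_bij/enum_val_bij.
rewrite [X in X * _]big_mkcond -big_split; apply: eq_bigr => k _ /=.
by rewrite enum_valK /mix; case: (form_of _ == i); rewrite ?exprMn ?mul1r.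
Qed.

(** By (A1) the zero set in slot j is a union of hyperplanes, one for each common
    zero of the other forms. *)
Lemma resultant_value_split j a :
  exists c, exists x : 'I_(delta d j) -> 'I_n -> C,
    factors_at (fun=> 1%N) resultant_value j a c x.
Proof.
have [[h0 /eqP Hh0]|H0] := EM (exists h, resultant_value (mix j a h) <> 0); last first.
  exists 0, (fun _ _ => 1); split=> [l|h|]; last by rewrite eqxx.
    by exists j; rewrite oner_neq0.
  by rewrite mul0r; apply: contrapT => H; apply: H0; exists h.
pose Y (y : T -> C) := exists2 x, nonzero x /\ (forall l, l != j -> dot a (pt 1 l x) = 0) &
  y = pt 1 j x.
have [D HD] := resultant_value_poly.
pose f h := resultant_value (mix j a h).
have f_poly : linepoly D f.
  move=> h h'; have [q sq Hq] := HD (mix j a h) (mix j (fun=> 0) h').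
  exists q => // s; rewrite -Hq line_mix /f; congr (resultant_value (mix j _ _)).
  by apply: funext => v; rewrite /line mulr0 addr0.
have f_homog c h : f (fun v => c * h v) = c ^+ delta d j * f h.
  rewrite /f -resultant_value_homog mix_mix; congr (resultant_value _).
  by apply: funext => v; rewrite /mix; case: eqP.
have f_van y h : Y y -> dot h y = 0 -> f h = 0.
  move=> [x [x0 Hx] ->] hx; apply/resultant_value0; exists x => // l.
  by have [->|lj] := eqVneq l j; rewrite ?dot_mix // dot_mix_neq // Hx.
have f_zero h : f h = 0 -> (exists2 y, Y y & dot h y = 0) \/
    exists p : void, dot h (of_void _ p) = 0 /\ dot h (of_void _ p) = 0.
  move=> /resultant_value0 [x x0 Hx]; left; exists (pt 1 j x).
    by exists x => //; split => // l lj; rewrite -(Hx l) dot_mix_neq.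
  by rewrite -(Hx j) dot_mix.
have [//|c [y [Yy Hf]]] := splitting f_poly f_homog Hh0 f_van _ f_zero.
suff /choice [x Hx] : forall l, exists x, (nonzero x /\
    (forall l, l != j -> dot a (pt 1 l x) = 0)) /\ y l = pt 1 j x.
  exists c, x; split=> [l|h|_ l]; try by case: (Hx l) => -[].
  by rewrite -/(f h) Hf; congr (_ * _); apply: eq_bigr => l _; rewrite (Hx l).2.
by move=> l; have [x Hx ->] := Yy l; exists x.
Qed.

Lemma resultant_value_like :
  resultant_like (fun=> 1%N) (delta d) predT resultant_value.
Proof.
split=> // [||a x x0 Hx|i a _].
- exact: resultant_value_poly.
- exact: resultant_value_homog.
- by apply/resultant_value0; exists x.
- exact: resultant_value_split.
Qed.

Lemma resultant_value_diagonal :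
  resultant_value (diagonal_form C (fun i b => (i == b : nat))) = 1.
Proof.
rewrite -(resultant_normalized ResP); apply: meval_eq => k /=.
rewrite /diagonal_form mpolyXn mcoeffX (bigD1 (form_of (enum_val k))) //=.
rewrite eqxx mulr1 big1 ?addr0 => [|b bk]; first by rewrite eq_sym.
by rewrite [form_of _ == b]eq_sym (negbTE bk) mulr0.
Qed.

End Resultant.

(** * The height bound *)

(** Exponential growth beats polynomial growth: if x / B = 1 + h with h > 0, take
    r = s (e+1), so that Bernoulli's inequality gives the power e+1 of s h against
    the power e of s. *)
Lemma le_of_power_le (R : realType) (x B A : R) e : 0 <= x -> 1 <= B ->
  (forall r, (0 < r)%N -> x ^+ r <= B ^+ r * (A * r%:R ^+ e)) -> x <= B.
Proof.
move=> x0 B1 H; rewrite leNgt; apply/negP => lt_Bx.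
have B0 : 0 < B := lt_le_trans ltr01 B1.
pose h := x / B - 1.
have h0 : 0 < h by rewrite subr_gt0 ltr_pdivlMr // mul1r.
have Hh r : (0 < r)%N -> (1 + h) ^+ r <= A * r%:R ^+ e.
  move=> r0; rewrite addrC subrK expr_div_n ler_pdivrMr ?exprn_gt0 //.
  by rewrite mulrC H.
have bernoulli s : s%:R * h <= (1 + h) ^+ s.
  elim: s => [|s IH]; first by rewrite mul0r ler01.
  rewrite exprS mulrDl mul1r -natr1 mulrDl mul1r lerD // ler_peMr ?(ltW h0) //.
  by rewrite exprn_ege1 // lerDl ltW.
have Hs s : (0 < s)%N -> s%:R * h ^+ e.+1 <= A * e.+1%:R ^+ e.
  move=> s0; have s0' : 0 < (s%:R : R) ^+ e by rewrite exprn_gt0 // ltr0n.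
  rewrite -(ler_pM2r s0') mulrAC -exprS -exprMn -mulrA -exprMn -natrM.
  apply: le_trans (Hh (e.+1 * s)%N _); last by rewrite muln_gt0.
  rewrite mulnC exprM; apply: lerXn2r; rewrite ?nnegrE.
  - by rewrite mulr_ge0 ?ler0n // ltW.
  - by rewrite exprn_ge0 // addr_ge0 // ltW.
  - exact: bernoulli.
have P0 : 0 < h ^+ e.+1 by rewrite exprn_gt0.
pose s := (Num.bound `|A * e.+1%:R ^+ e / h ^+ e.+1|).+1.
have := Hs s (ltn0Sn _); rewrite -ler_pdivlMr // leNgt; case/negP.
apply: le_lt_trans (ler_norm _) (lt_trans (archi_boundP (normr_ge0 _)) _).
by rewrite ltr_nat.
Qed.

Lemma normc_normE (R : realType) (z : R[i]) :
  `|z| = (ComplexField.Normc.normc z)%:C%C.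
Proof. by case: z => a b; rewrite normc_def. Qed.

Lemma growth_bound n P rho : (0 < rho)%N ->
  ((2 * (rho ^ n * P).+1) ^ (n * n) * (n`! * (rho ^ n * P).+1 ^ n) <=
   ((2 * P.+1) ^ (n * n) * (n`! * P.+1 ^ n)) * rho ^ (n * (n * n + n)))%N.
Proof.
move=> r0; have HM : ((rho ^ n * P).+1 <= P.+1 * rho ^ n)%N.
  by rewrite mulSn [(P * _)%N]mulnC -add1n leq_add2r expn_gt0 r0.
have mono m p e : (m <= p)%N -> (m ^ e <= p ^ e)%N.
  by move=> mp; case: e => // e; rewrite leq_exp2r.
apply: (@leq_trans ((2 * (P.+1 * rho ^ n)) ^ (n * n) * (n`! * (P.+1 * rho ^ n) ^ n))%N).
  apply: leq_mul; first by apply: mono; rewrite leq_mul2l HM orbT.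
  by rewrite leq_mul2l mono ?orbT.
rewrite mulnDr expnD !expnM !expnMn -!expnM; apply: eq_leq; ring.
Qed.

Theorem theorem8p1 (R : realType) (n : nat) (d : 'I_n -> nat)
    (n_ge1 : (1 <= n)%N) (d_ge1 : forall i : 'I_n, (1 <= d i)%N)
    (Res : coefpoly R d) (ResP : is_resultant Res) :
  height Res <=
    \prod_(i < n) ('C((d i + n - 1)%N, (n - 1)%N)%:R : R) ^+ delta d i.
Proof.
set B : R := \prod_(i < n) _.
have EB : B = (\prod_(i < n) count_monomials d i ^ delta d i)%N%:R.
  rewrite natr_prod; apply: eq_bigr => i _.
  by rewrite natrX count_monomialsE.
have B1 : 1 <= B.
  rewrite EB ler1n; apply: prodn_gt0 => i; rewrite expn_gt0 count_monomialsE.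
  by rewrite bin_gt0 leq_sub2r // leq_addl.
suff H m : ComplexField.Normc.normc Res@_m <= B.
  rewrite /height; elim/big_ind: _ => [|x y Hx Hy|m _]; last exact: H.
    exact: le_trans ler01 B1.
  by rewrite ge_max Hx Hy.
rewrite -lecR -normc_normE; apply: coef_bound => a Ha.
pose a' v := a (enum_rank v).
have -> : Res.@[a] = resultant_value Res a'.
  by apply: meval_eq => k; rewrite /a' enum_valK.
rewrite normc_normE lecR.
pose P := (\prod_(i < n) delta d i)%N.
apply: (le_of_power_le (A := ((2 * P.+1) ^ (n * n) * (n`! * P.+1 ^ n))%N%:R)
  (e := (n * (n * n + n))%N) _ B1) => [|rho rho0].
  by rewrite -lecR -normc_normE normr_ge0.
have a'1 v : `|a' v| <= 1 by rewrite Ha.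
have := resultant_power_bound d_ge1 (resultant_value_like ResP)
  (resultant_value_diagonal ResP) rho0 a'1.
have -> : (\prod_(i < n | 0 <= i) (rho * delta d i) = rho ^ n * P)%N.
  by rewrite big_split /= prod_nat_const card_ord.
rewrite normc_normE => H; rewrite -lecR rmorphXn; apply: le_trans H _.
have -> : \prod_i (count_monomials d i)%:R ^+ delta d i =
    (\prod_(i < n) count_monomials d i ^ delta d i)%N%:R :> R[i].
  by rewrite natr_prod; apply: eq_bigr => i _; rewrite natrX.
by rewrite EB -!natrX -!natrM rmorph_nat ler_nat leq_mul2l growth_bound ?orbT.
Qed.
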